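(* For $n=2$ and $f\in\mathcal{D}_{+}(\mathbb{R}^{2})$, the Lie bracket of the coordinate vector fields $L_{1},L_{2}$, in the standard convention $[L_{1},L_{2}](f)=DL_{2}[f](L_{1}f)-DL_{1}[f](L_{2}f)$, is $$[L_{1},L_{2}]\,f=\Big[w'\big(F_{2}(x_{2})\big)\,\gamma_{1}(x_{2})-w'\big(F_{1}(x_{1})\big)\,\gamma_{2}(x_{1})\Big]\,f,$$ $$\gamma_{2}(x_{1})=\operatorname{Cov}\big(w(F_{2}(X_{2})),\,\mathbf{1}\{X_{1}\le x_{1}\}\big),$$ and symmetrically $\gamma_{1}(x_{2})=\operatorname{Cov}\big(w(F_{1}(X_{1})),\,\mathbf{1}\{X_{2}\le x_{2}\}\big)$. The bracket vanishes under independence, and the multiplier in square brackets depends on $f$ only through its copula, evaluated at the marginal ranks. Conversely, if the brackets of the full family $\{w_{k,\alpha}\}$ all vanish, then $X_{1}$ and $X_{2}$ are independent.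
   Context: $\mathcal{D}_{+}(\mathbb{R}^{n})$ is the set of joint probability densities on $\mathbb{R}^{n}$ that are continuous and strictly positive on an open rectangle (possibly all of $\mathbb{R}^{n}$) and vanish outside it. $(X_{1},X_{2})$ has joint density $f$, with marginal distribution functions $F_{1},F_{2}$; the marginal ranks are $F_{1}(x_{1}),F_{2}(x_{2})$, and the copula of $f$ is the joint law of $(F_{1}(X_{1}),F_{2}(X_{2}))$. A kernel is a probability density $w$ on $[0,1]$, and $\mathcal{W}$ is the set of kernels. For $w\in\mathcal{W}$ the coordinate vector fields are $L_{i}f=\big(w(F_{i}(x_{i}))-1\big)f$, $i=1,2$, where $F_{i}$ is the $i$-th marginal distribution function of the current $f$; $w'$ is the derivative of $w$. $DL[f](h)$ denotes the derivative at $f$ in the direction $h$ of the map $f\mapsto Lf$, including the dependence of the $F_{i}$ on $f$. The phase-shifted kernels are $w_{k,\alpha}(z)=2\sin^{2}\big(k\pi(z+\alpha)\big)$, $k=1,2,\ldots$, $\alpha\in[0,1)$. *)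

(* Defs.v *)
From HB Require Import structures.
From mathcomp Require Export all_boot all_order all_algebra.
From mathcomp Require Export all_classical all_reals all_analysis.
Export Order.TTheory GRing.Theory Num.Theory numFieldNormedType.Exports.

Set Implicit Arguments.
Unset Strict Implicit.
Unset Printing Implicit Defensive.

Local Open Scope classical_set_scope.
Local Open Scope ring_scope.

Definition leb2 (R : realType)
    : {measure set (measurableTypeR R * measurableTypeR R) -> \bar R} :=
  (@lebesgue_measure R \x @lebesgue_measure R)%E.
Arguments leb2 R : clear implicits.

Definition open_rectangle (R : realType) (a b : \bar R * \bar R) : set (R * R) :=
  [set x | (a.1 < x.1%:E < b.1)%E /\ (a.2 < x.2%:E < b.2)%E].

(* Infinite bounds are allowed, so the rectangle may be all of the plane; it is
   nonempty because the total mass is 1. *)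
Definition Dplus (R : realType) (f : R * R -> R) : Prop :=
  (exists a b : \bar R * \bar R,
     [/\ (forall x, open_rectangle a b x -> {for x, continuous f}),
         (forall x, open_rectangle a b x -> 0 < f x) &
         (forall x, ~ open_rectangle a b x -> f x = 0)]) /\
  (\int[leb2 R]_x (f x)%:E = 1)%E.

(* Only the values of w on [0, 1] are constrained: marginal ranks lie there. *)
Definition is_kernel (R : realType) (w : R -> R) : Prop :=
  [/\ measurable_fun (`[0, 1] : set R) w,
      (forall z, 0 <= z <= 1 -> 0 <= w z) &
      (\int[lebesgue_measure]_(z in `[0%R, 1%R]) (w z)%:E = 1)%E].

Definition phase_kernel (R : realType) (k : nat) (alpha : R) : R -> R :=
  fun z => 2 * sin (k%:R * pi * (z + alpha)) ^+ 2.

(* The coordinate is selected by the projection p, either fst or snd. *)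
Definition marginal_cdf (R : realType) (p : R * R -> R) (f : R * R -> R) (s : R)
    : R :=
  \int[leb2 R]_(x in [set x | p x <= s]) f x.

Definition coord_field (R : realType) (w : R -> R) (p : R * R -> R)
    (f : R * R -> R) : R * R -> R :=
  fun x => (w (marginal_cdf p f (p x)) - 1) * f x.

(* DL[f](h) is the pointwise Gateaux derivative: at each point x it is the
   derivative at t = 0 of the scalar function t |-> L(f + t h)(x). *)
Definition along (R : realType) (L : (R * R -> R) -> (R * R -> R))
    (f h : R * R -> R) (x : R * R) : R -> R :=
  fun t => L (fun z => f z + t * h z) x.

Definition dir_derivable (R : realType) (L : (R * R -> R) -> (R * R -> R))
    (f h : R * R -> R) : Prop :=
  forall x, derivable (along L f h x) 0 1.

Definition dir_derive (R : realType) (L : (R * R -> R) -> (R * R -> R))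
    (f h : R * R -> R) : R * R -> R :=
  fun x => derive1 (along L f h x) 0.

Definition lie_bracket (R : realType) (L1 L2 : (R * R -> R) -> (R * R -> R))
    (f : R * R -> R) : R * R -> R :=
  fun x => dir_derive L2 f (L1 f) x - dir_derive L1 f (L2 f) x.

(* As a law, only its values on Borel sets are meaningful. *)
Definition joint_law (R : realType) d (T : measurableType d)
    (P : probability T R) (X Y : T -> R) : set (R * R) -> \bar R :=
  pushforward P (fun t => (X t, Y t)).

Definition has_joint_density (R : realType) d (T : measurableType d)
    (P : probability T R) (X Y : T -> R) (f : R * R -> R) : Prop :=
  forall A : set (measurableTypeR R * measurableTypeR R), measurable A ->
    joint_law P X Y A = (\int[leb2 R]_(x in A) (f x)%:E)%E.

Definition copula (R : realType) d (T : measurableType d)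
    (P : probability T R) (X Y : T -> R) (f : R * R -> R)
    : set (R * R) -> \bar R :=
  joint_law P (marginal_cdf fst f \o X) (marginal_cdf snd f \o Y).

Definition independent_RV (R : realType) d (T : measurableType d)
    (P : probability T R) (X Y : T -> R) : Prop :=
  forall A B : set R, measurable A -> measurable B ->
    P (X @^-1` A `&` Y @^-1` B) = (P (X @^-1` A) * P (Y @^-1` B))%E.

Definition gamma_cov (R : realType) d (T : measurableType d)
    (P : probability T R) (w F : R -> R) (X Y : T -> R) (s : R) : R :=
  fine (covariance P (w \o F \o X) (\1_[set t | Y t <= s])).

Definition multiplier (R : realType) d (T : measurableType d)
    (P : probability T R) (X1 X2 : T -> R) (w : R -> R) (f : R * R -> R)
    (x : R * R) : R :=
  let F1 := marginal_cdf fst f in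
  let F2 := marginal_cdf snd f in
  derive1 w (F2 x.2) * gamma_cov P w F1 X1 X2 x.2
  - derive1 w (F1 x.1) * gamma_cov P w F2 X2 X1 x.1.

(* Main.v *)
From HB Require Import structures.
Require Import Defs.
From mathcomp Require Import measurable_realfun ring lra.
Local Open Scope classical_set_scope.
Local Open Scope ring_scope.

(** Two facts drive the theorem.

    The first is the probability integral transform.  The marginals have no atoms,
    so each rank [F_i (X_i)] is uniform on the unit interval
    ([rank_uniform]) and [w (F_i (X_i))] has mean 1 for every kernel [w]
    ([integral_kernel_rank]).  A marginal distribution function is linear in the
    density; along the field [L_p] the distribution function of the other
    coordinate [q] therefore moves at the rate given by the integral of
    [(w (F_p) - 1) f] over a half-plane, and mean 1 turns that rate into the
    covariance [gamma] ([integral_coord_field]).  Differentiating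
    [(w (F_q) - 1) f] along [L_p] gives one term from the rank and one from the
    factor [f]; the second is symmetric in the two fields and cancels in the bracket
    ([lie_bracket_multiplier]).  Outside the rectangle the fields vanish, and
    inside it both ranks are interior, where [w] is differentiable.  Under independence the
    covariances are zero.  They are functions of the copula because the events
    [Y <= s] and [F Y <= F s] differ by a null event ([gamma_cov_copula]).

    The second fact is that trigonometric moments determine a law, and it gives the
    converse.  Where the density is positive, the vanishing of the bracket equates a
    function of the second rank with a function of the first.  Since all interior
    ranks occur independently in a rectangle, the first rank can be placed at a zero
    of the derivative of the kernel, and
    [sin (2 k pi (v + alpha)) * E[cos (2 k pi (U + alpha)); V <= v] = 0] follows
    ([phase_product]), where [U] and [V] are the two ranks.  For a given [v] three
    phases [alpha] suffice to make both moments of order [k] vanish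
    ([fourier_coef0]).  They vanish as well without the restriction [V <= v], by
    uniformity, so the event [V <= v] is uncorrelated with every trigonometric
    polynomial in [U].  Indicators of arcs are bounded limits of such polynomials
    ([trig_decorrelation_indep]), hence the joint distribution function is the product
    of its marginals, which is independence ([indep_of_rays]). *)

Set Implicit Arguments.
Unset Strict Implicit.
Unset Printing Implicit Defensive.

(** * Finite measures on the line, Borel sets of the plane, densities *)

Section Rays.
Context (R : realType).

Lemma measurable_generated_by_rays :
  @measurable _ (measurableTypeR R) = <<s range (fun x : R => `]-oo, x]%classic) >>.
Proof.
rewrite [LHS](RGenOInfty.measurableE R); apply/seteqP; split.
  apply: smallest_sub; first exact: smallest_sigma_algebra.
  move=> _ [x ->]; rewrite -setCitvl.
  rewrite -setTD; apply: sigma_algebraCD; apply: sub_sigma_algebra.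
  by exists x.
apply: smallest_sub; first exact: smallest_sigma_algebra.
move=> _ [x _ <-]; rewrite -setCitvr.
rewrite -setTD; apply: sigma_algebraCD; apply: sub_sigma_algebra.
by exists x.
Qed.

Lemma eq_measure_of_rays (m1 m2 : {measure set (measurableTypeR R) -> \bar R}) :
  (forall x, m1 `]-oo, x]%classic = m2 `]-oo, x]%classic) ->
  (forall x, (m1 `]-oo, x]%classic < +oo)%E) ->
  forall A : set R, measurable A -> m1 A = m2 A.
Proof.
move=> m12 fin A mA.
apply: (@measure_unique _ _ (measurableTypeR R) (range (fun x : R => `]-oo, x]%classic))
  (fun n => `]-oo, n%:R]%classic) _ _ _ _ m1 m2 _ _ A mA) => //.
- exact: measurable_generated_by_rays.
- move=> _ _ [x _ <-] [y _ <-]; exists (Num.min x y) => //.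
  by apply/seteqP; split => z /=; rewrite !in_itv /= le_min => /andP.
- apply/seteqP; split => // z _; exists (Num.truncn `|z|).+1 => //=.
  rewrite in_itv /=; apply: (le_trans (ler_norm z)).
  exact/ltW/truncnS_gt.
- by move=> _ [x _ <-].
Qed.

(** Every point of an open set of the plane has a rational box around it inside
    that set, and there are countably many such boxes. *)
Lemma open_measurable_prod (O : set (R * R)) :
  open O -> measurable (O : set (measurableTypeR R * measurableTypeR R)).
Proof.
move=> oO.
pose box (i : rat * rat * (rat * rat)) : set (R * R) :=
  `]ratr i.1.1, ratr i.1.2[%classic `*` `]ratr i.2.1, ratr i.2.2[%classic.
have -> : O = \bigcup_(i in [set i | box i `<=` O]) box i.
  apply/seteqP; split => [x Ox|x [i /= iO ix]]; last exact: iO.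
  have /nbhs_ballP[e /= e0 eO] : nbhs x O by exact: open_nbhs_nbhs.
  have lt1 (y : R) : y - e < y by rewrite ltrBlDr ltrDl.
  have lt2 (y : R) : y < y + e by rewrite ltrDl.
  have [q1 q1P] := rat_in_itvoo (lt1 x.1); have [q2 q2P] := rat_in_itvoo (lt2 x.1).
  have [q3 q3P] := rat_in_itvoo (lt1 x.2); have [q4 q4P] := rat_in_itvoo (lt2 x.2).
  move: q1P q2P q3P q4P; rewrite !in_itv /=.
  move=> /andP[? ?] /andP[? ?] /andP[? ?] /andP[? ?].
  exists ((q1, q2), (q3, q4)) => /=; last first.
    by split; rewrite /= in_itv /=; apply/andP.
  move=> z [/=]; rewrite !in_itv /= => /andP[? ?] /andP[? ?].
  by apply: eO; split; rewrite /ball /= ltr_distl; apply/andP; split; lra.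
rewrite bigcup_mkcond; apply: countable_bigcupT_measurable => [|i].
  exact: countableP.
  by case: ifPn => // _; apply: measurableX; exact: measurable_itv.
Qed.

End Rays.

(** The change of measure is the hypothesis itself for indicators; it extends to
    simple functions by linearity and to nonnegative functions by monotone
    convergence. *)
Section Density.
Context d (T : measurableType d) (R : realType).
Variables (mu nu : {measure set T -> \bar R}) (g : T -> R).
Hypothesis mg : measurable_fun setT g.
Hypothesis g0 : forall x, 0 <= g x.
Hypothesis nuE : forall A, measurable A -> nu A = (\int[mu]_(x in A) (g x)%:E)%E.

Import HBNNSimple.
Local Open Scope ereal_scope.

Let integral_density_nnsfun (h : {nnsfun T >-> R}) :
  \int[nu]_x (h x)%:E = \int[mu]_x ((h x)%:E * (g x)%:E).
Proof.
under [LHS]eq_integral do rewrite fimfunE -fsumEFin//.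
rewrite [LHS]ge0_integral_fsum//; last 2 first.
  - by move=> r; exact/measurable_EFinP/measurableT_comp.
  - by move=> n x _; rewrite EFinM nnfun_muleindic_ge0.
under [RHS]eq_integral.
  move=> x xD; rewrite fimfunE -fsumEFin// ge0_mule_fsuml; last first.
    by move=> r; rewrite EFinM nnfun_muleindic_ge0.
  over.
rewrite [RHS]ge0_integral_fsum//; last 2 first.
  - move=> r; apply: emeasurable_funM; last exact/measurable_EFinP.
    by apply/measurable_EFinP; apply/measurableT_comp.
  - move=> n x _; apply: mule_ge0; last by rewrite lee_fin.
    by rewrite EFinM nnfun_muleindic_ge0.
apply: eq_fsbigr => r rh.
rewrite integralZl_indic_nnsfun//= integral_indic//= setIT nuE//.
have r0 : (0 <= r)%R by move: rh; rewrite inE => -[x _ <-].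
under [RHS]eq_integral do rewrite EFinM -muleA.
rewrite ge0_integralZl//=; last 2 first.
  - apply: emeasurable_funM; last exact/measurable_EFinP.
    by apply/measurable_EFinP.
  - by move=> x _; rewrite mule_ge0 ?lee_fin.
congr (_ * _); rewrite integral_mkcond; apply: eq_integral => x _.
rewrite patchE indicE; case: ifPn => _; first by rewrite mul1e.
by rewrite mul0e.
Qed.

Lemma ge0_integral_density (D : set T) (f : T -> \bar R) :
  measurable D -> measurable_fun D f -> (forall x, D x -> 0 <= f x) ->
  \int[nu]_(x in D) f x = \int[mu]_(x in D) (f x * (g x)%:E).
Proof.
move=> mD mf f0.
rewrite integral_mkcond [RHS]integral_mkcond.
have {mf} mf : measurable_fun setT (f \_ D).
  by apply/(measurable_restrictT _ _).1.
have {}f0 x : 0 <= (f \_ D) x by rewrite patchE; case: ifPn => // /set_mem /f0.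
under [RHS]eq_integral => x _.
  rewrite (_ : ((fun x => f x * (g x)%:E) \_ D) x = (f \_ D) x * (g x)%:E);
    last by rewrite !patchE; case: ifPn => //; rewrite mul0e.
  over.
move: (f \_ D) mf f0 => {f mD}f mf f0.
pose f_ := nnsfun_approx measurableT mf.
transitivity (lim (\int[nu]_x (f_ n x)%:E @[n --> \oo])).
  rewrite -monotone_convergence//=.
  - apply: eq_integral => ? /[!inE] xD; apply/esym/cvg_lim => //=.
    exact: cvg_nnsfun_approx.
  - by move=> n; exact/measurable_EFinP/measurable_funTS.
  - by move=> n ? _; rewrite lee_fin.
  - by move=> ? _ ? ? mn; rewrite lee_fin; exact/lefP/nd_nnsfun_approx.
transitivity (lim (\int[mu]_x ((f_ n x)%:E * (g x)%:E) @[n --> \oo])).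
  by apply: congr_lim; apply/funext => n /=; exact: integral_density_nnsfun.
rewrite -monotone_convergence//=.
- apply: eq_integral => x _; apply/cvg_lim => //=.
  apply: cvgeZr => //.
  by apply: cvg_nnsfun_approx.
- by move=> n; apply: emeasurable_funM; apply/measurable_EFinP.
- by move=> n ? _; rewrite mule_ge0 ?lee_fin.
- move=> ? _ ? ? mn; rewrite lee_wpmul2r ?lee_fin//.
  exact/lefP/nd_nnsfun_approx.
Qed.

End Density.

(** * The probability integral transform *)

(** The distribution function enters only through [FE], so that it can be any
    expression for it, in particular a marginal of a joint density. *)
Section IntegralTransform.
Context (R : realType) d (T : measurableType d) (P : probability T R).
Variables (X : {RV P >-> R}) (F : R -> R).
Hypothesis FE : forall s, P [set t | X t <= s] = (F s)%:E.
Hypothesis noatom : forall s, P [set t | X t = s] = 0%E.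

Lemma measurable_le_RV s : measurable [set t | X t <= s].
Proof.
have := @measurable_funPTI _ _ _ _ X `]-oo, s]%classic.
rewrite (_ : X @^-1` _ = [set t | X t <= s]); first by apply.
by apply/seteqP; split => t /=; rewrite in_itv.
Qed.

Lemma measurable_lt_RV s : measurable [set t | X t < s].
Proof.
have := @measurable_funPTI _ _ _ _ X `]-oo, s[%classic.
rewrite (_ : X @^-1` _ = [set t | X t < s]); first by apply.
by apply/seteqP; split => t /=; rewrite in_itv.
Qed.

Lemma cdf01 s : 0 <= F s <= 1.
Proof.
rewrite -!lee_fin -FE measure_ge0 /=.
exact/probability_le1/measurable_le_RV.
Qed.

Lemma cdf_nd : {homo F : x y / x <= y}.
Proof.
move=> x y xy; rewrite -lee_fin -!FE; apply: le_measure.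
- by rewrite inE; exact: measurable_le_RV.
- by rewrite inE; exact: measurable_le_RV.
- by move=> t /=; move/le_trans; apply.
Qed.

Lemma prob_lt_RV s : P [set t | X t < s] = (F s)%:E.
Proof.
rewrite -FE (_ : [set t | X t <= s] = [set t | X t < s] `|` [set t | X t = s]);
  last first.
  apply/seteqP; split => t /=.
    by rewrite le_eqVlt => /orP[/eqP|]; [right|left].
  by case=> [/ltW//|->].
have mX : measurable [set t | X t = s].
  exact: (@measurable_funPTI _ _ _ _ X [set s]).
rewrite measureU//.
- by rewrite [X in (_ + X)%E]noatom adde0.
- exact: measurable_lt_RV.
- by apply/seteqP; split => t //= [] /[swap] ->; rewrite ltxx.
Qed.

(** Every distribution function is right-continuous.  That of [- X] is
    [r |-> 1 - F (- r)] when there are no atoms, and its right-continuity is the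
    left-continuity of [F]. *)
Lemma cdf_continuous : continuous F.
Proof.
have Fr (Y : {RV P >-> R}) (G : R -> R) :
    (forall s, P [set t | Y t <= s] = (G s)%:E) ->
    forall s, G x @[x --> s^'+] --> G s.
  move=> GE s.
  have cE r : cdf Y r = (G r)%:E.
    by rewrite /cdf /distribution /pushforward -GE; congr (P _).
  have := @cdf_right_continuous _ _ _ P Y s.
  rewrite cE (_ : cdf Y = (EFin \o G)); last exact/funext.
  by move/fine_cvg.
move=> s; apply/left_right_continuousP; split; last exact: Fr.
have mN : measurable_fun setT (fun t => - X t).
  exact: measurableT_comp.
pose Y : {RV P >-> R} := HB.pack (fun t => - X t)
  (isMeasurableFun.Build _ _ _ _ (fun t => - X t) mN).
have YE r : P [set t | Y t <= r] = (1 - F (- r))%:E.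
  rewrite EFinB -(prob_lt_RV (- r)).
  rewrite (_ : [set t | Y t <= r] = ~` [set t | X t < - r]).
    by rewrite probability_setC//; exact: measurable_lt_RV.
  apply/seteqP; split => t /=; rewrite lerNl; first by rewrite leNgt => /negP.
  by move/negP; rewrite -leNgt.
apply/cvg_at_leftNP.
rewrite (_ : F \o -%R = (fun x => 1 - (1 - F (- x)))); last first.
  by apply/funext => x /=; rewrite opprB addrCA subrr addr0.
rewrite (_ : F s = 1 - (1 - F (- - s))); last first.
  by rewrite opprK opprB addrCA subrr addr0.
by apply: cvgB; [exact: cvg_cst|exact: Fr YE _].
Qed.

Lemma cdf_surj u : 0 < u < 1 -> exists x, F x = u.
Proof.
move=> /andP[u0 u1].
have cE : fine \o cdf X = F.
  apply/funext => r /=; rewrite /cdf /distribution /pushforward.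
  by rewrite (_ : X @^-1` _ = [set t | X t <= r]) ?FE.
have FN : F x @[x --> -oo] --> (0 : R).
  by rewrite -cE; exact/fine_cvg/cvg_cdfNy0.
have FP : F x @[x --> +oo] --> (1 : R).
  by rewrite -cE; exact/fine_cvg/cvg_cdfy1.
have [a [_ aP]] : \forall x \near -oo, F x < u by exact: (cvgr_lt _ FN).
have [b [_ bP]] : \forall x \near +oo, u < F x by exact: (cvgr_gt _ FP).
have Fa := aP (a - 1) ltac:(lra); have Fb := bP (b + 1) ltac:(lra).
have ab : a - 1 <= b + 1.
  rewrite leNgt; apply/negP => /ltW /cdf_nd.
  by move/(lt_le_trans Fb)/lt_trans => /(_ _ Fa); rewrite ltxx.
have [||c _ cu] := @IVT _ F _ _ u ab; last by exists c.
- exact/continuous_subspaceT/cdf_continuous.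
- by rewrite ge_min le_max (ltW Fa) (ltW Fb) orbT.
Qed.

Lemma measurable_cdf : measurable_fun setT F.
Proof. by apply: nondecreasing_measurable => // x y; exact: cdf_nd. Qed.

Lemma measurable_cdf_RV : measurable_fun setT (F \o X).
Proof. exact: measurableT_comp measurable_cdf _. Qed.

Definition rank_RV : {RV P >-> measurableTypeR R} :=
  HB.pack (F \o X : T -> measurableTypeR R)
    (isMeasurableFun.Build _ _ T (measurableTypeR R) (F \o X) measurable_cdf_RV).

Let measurable_rank_le u : measurable [set t | F (X t) <= u].
Proof.
have := @measurable_funPTI _ _ _ _ rank_RV `]-oo, u]%classic.
rewrite (_ : _ @^-1` _ = [set t | F (X t) <= u]); first by apply.
by apply/seteqP; split => t /=; rewrite in_itv.
Qed.

(** If [F x = u] then [X <= x] implies [F X <= u], which gives one bound.  For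
    the other, [F X <= u] forces [X <= y] as soon as [F y > u], and [F] takes
    all values just above [u]. *)
Let prob_rank_le u : 0 < u < 1 -> P [set t | F (X t) <= u] = u%:E.
Proof.
move=> u01; have mX v := measurable_le_RV v; have mF v := measurable_rank_le v.
have [x xu] := cdf_surj u01.
apply/eqP; rewrite eq_le; apply/andP; split; last first.
  rewrite -xu -FE; apply: le_measure; rewrite ?inE//.
  by move=> t /= /cdf_nd.
apply/lee_addgt0Pr => e e0.
have [u1|u1] := ltP (u + e) 1; last first.
  rewrite -EFinD; apply: (@le_trans _ _ 1%E); last by rewrite lee_fin.
  exact: probability_le1.
have [|y yu] := @cdf_surj (u + e); first by apply/andP; split => //; lra.
rewrite -EFinD -yu -FE; apply: le_measure; rewrite ?inE//.
move=> t /= Ft; rewrite leNgt; apply/negP => /ltW /cdf_nd.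
by rewrite yu => /le_trans /(_ Ft); lra.
Qed.

Lemma rank_uniform A : measurable A ->
  P ((F \o X) @^-1` A) = uniform_prob (@ltr01 R) A.
Proof.
move=> mA.
have H : forall x, distribution P rank_RV `]-oo, x]%classic =
    uniform_prob (@ltr01 R) `]-oo, x]%classic.
  move=> u; rewrite /distribution /pushforward.
  rewrite (_ : _ @^-1` _ = [set t | F (X t) <= u]); last first.
    by apply/seteqP; split => t /=; rewrite in_itv.
  rewrite /uniform_prob integral_uniform_pdf.
  have mF v := measurable_rank_le v.
  have [u1|u1] := leP 1 u.
    rewrite (_ : [set t | _] = setT); last first.
      apply/seteqP; split => t //= _.
      by have /andP[_ /le_trans] := cdf01 (X t); apply.
    rewrite probability_setT setIidr; last first.
      by move=> x /=; rewrite !in_itv /= => /andP[_ /le_trans]; apply.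
    by rewrite integral_uniform_pdf1.
  rewrite (eq_integral (fun=> 1%E)); last first.
    move=> x; rewrite inE /= !in_itv /= => -[_ x01].
    by rewrite /uniform_pdf x01 subr0 invr1.
  have [u0|u0] := ltP 0 u.
    rewrite prob_rank_le ?u0//.
    rewrite (_ : _ `&` _ = `[0, u]%classic); last first.
      apply/seteqP; split => x /=; rewrite !in_itv /=.
        by move=> [? /andP[? _]]; apply/andP.
      by move=> /andP[? ?]; split => //; apply/andP; split => //; lra.
    rewrite integral_cst//= mul1e lebesgue_measure_itv /= lte_fin u0.
    by rewrite sube0.
  rewrite [RHS]null_set_integral//; last 2 first.
  - exact: measurableI.
  - apply: (@subset_measure0 _ _ _ lebesgue_measure _ [set 0 : R]) => //.
    + exact: measurableI.
    + move=> x /=; rewrite !in_itv /= => -[? /andP[? _]].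
      by apply/eqP; rewrite eq_le; apply/andP; split; lra.
    + exact: lebesgue_measure_set1.
  (* An atom of the rank at 0 is excluded by comparison with small levels. *)
  apply/eqP; rewrite -measure_le0; apply/lee_addgt0Pr => e e0; rewrite add0e.
  have e2 : 0 < Num.min e (1/2) < 1.
    by rewrite lt_min gt_min; apply/andP; split; [|apply/orP; right]; lra.
  apply: (@le_trans _ _ (Num.min e (1/2))%:E); last by rewrite lee_fin ge_min lexx.
  rewrite -(prob_rank_le e2); apply: le_measure; rewrite ?inE//.
  by move=> t /= /le_trans; apply; move: e2; lra.
apply: (@eq_measure_of_rays R (distribution P rank_RV)
  (uniform_prob (@ltr01 R)) H _ A mA) => x.
by rewrite (le_lt_trans (probability_le1 _ _))// ltry.
Qed.

Lemma ge0_integral_rank (w : R -> R) : measurable_fun (`[0, 1] : set R) w ->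
  (forall z, 0 <= z <= 1 -> 0 <= w z) ->
  (\int[P]_t (w (F (X t)))%:E = \int[lebesgue_measure]_(z in `[0%R, 1%R]) (w z)%:E)%E.
Proof.
move=> mw w0.
have w0' z : z \in `[0, 1]%classic -> (0 <= (w z)%:E)%E.
  by rewrite inE /= in_itv /= lee_fin; exact: w0.
have mw' : @measurable_fun _ _ (measurableTypeR R) _ `[0, 1]%classic (EFin \o w).
  exact/measurable_EFinP.
have := @ge0_integral_pushforward _ _ T (measurableTypeR R) R rank_RV
  (@measurable_funPT _ _ _ _ rank_RV) P
  `[0, 1]%classic (EFin \o w) _ mw' w0'.
rewrite (_ : _ @^-1` _ = setT); last first.
  by apply/seteqP; split => t //= _; rewrite in_itv /= cdf01.
move=> <-//.
rewrite (@ge0_integral_density _ _ _ (@lebesgue_measure R) (distribution P rank_RV)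
  (uniform_pdf 0 1)) //.
- apply: eq_integral => z; rewrite inE /= in_itv /= => z01.
  by rewrite /uniform_pdf z01 subr0 invr1 mule1.
- exact: measurable_uniform_pdf.
- by move=> x; exact: uniform_pdf_ge0.
- by move=> A mA; exact: rank_uniform.
Qed.

Lemma prob_rank_eq u : P [set t | F (X t) = u] = 0%E.
Proof.
have := @rank_uniform [set u] (measurable_set1 _).
by rewrite /uniform_prob integral_set1.
Qed.

(** The event [X <= s] is contained in [F X <= F s], and the difference lies in
    the null event [F X = F s].  Hence events about [X] can be expressed through
    ranks alone. *)
Lemma ge0_integral_le_rank (f : T -> \bar R) s :
  measurable_fun setT f -> (forall t, (0 <= f t)%E) ->
  (\int[P]_(t in [set t | (X t <= s)%R]) f t =
   \int[P]_(t in [set t | (F (X t) <= F s)%R]) f t)%E.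
Proof.
move=> mf f0.
have mF := measurable_rank_le (F s).
have sub : [set t | X t <= s] `<=` [set t | F (X t) <= F s].
  by move=> t /= /cdf_nd.
have mX := measurable_le_RV s.
rewrite [RHS](@ge0_negligible_integral _ _ _ _ _
  ([set t | F (X t) <= F s] `\` [set t | X t <= s]))//.
- by rewrite setDD setIidr.
- exact: measurableD.
- exact: measurable_funTS.
- apply: (@subset_measure0 _ _ _ _ _ [set t | F (X t) = F s]) => //.
  + exact: measurableD.
  + exact: (@measurable_funPTI _ _ _ _ rank_RV [set F s]).
  + move=> t /= [Fts /negP]; rewrite -ltNge => /ltW /cdf_nd sF.
    by apply/eqP; rewrite eq_le Fts sF.
  + exact: prob_rank_eq.
Qed.

End IntegralTransform.

(** * Densities that are positive on an open rectangle *)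

Lemma leb2_rectangle (R : realType) (A B : set (measurableTypeR R)) :
  measurable A -> measurable B ->
  leb2 R (A `*` B) = (lebesgue_measure A * lebesgue_measure B)%E.
Proof. exact: product_measure1E. Qed.

Section Dplus.
Context (R : realType) (f : R * R -> R).
Hypothesis fD : Dplus f.
Local Notation mR := (measurableTypeR R).

Lemma Dplus_ge0 x : 0 <= f x.
Proof.
have [[a [b [_ fpos f0]]] _] := fD.
have [/fpos/ltW//|/f0->//] := pselect (open_rectangle a b x).
Qed.

(** At a point where [f > r >= 0] the density is nonzero, so the point lies in the
    rectangle and [f] is continuous there.  The case [r = 0] says that the
    positivity set is open, and all cases together give measurability. *)
Lemma Dplus_open r : 0 <= r -> open [set x | r < f x].
Proof.
have [[a [b [fc _ f0]]] _] := fD => r0.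
rewrite openE => x /= rx.
have [Qx|/f0 fx0] := pselect (open_rectangle a b x); last first.
  by move: rx; rewrite fx0 ltNge r0.
exact: (cvgr_gt (f x) (fc _ Qx)).
Qed.

Lemma Dplus_measurable : @measurable_fun _ _ (mR * mR)%type R setT f.
Proof.
move=> mT; apply: (measurability _ (RGenOInfty.measurableE R)) => //.
move=> _ [_ [r ->] <-]; rewrite setTI.
have -> : f @^-1` `]r, +oo[ = [set x | r < f x].
  by apply/seteqP; split => x /=; rewrite in_itv /= andbT.
have [r0|r0] := leP 0 r; first by apply: open_measurable_prod; exact: Dplus_open.
rewrite (_ : [set x | r < f x] = setT)//.
by apply/seteqP; split => // x _ /=; exact: lt_le_trans (Dplus_ge0 x).
Qed.

Lemma Dplus_integrable : (leb2 R).-integrable setT (EFin \o f).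
Proof.
apply/integrableP; split; first by apply/measurable_EFinP; exact: Dplus_measurable.
under eq_integral do rewrite /= ger0_norm ?Dplus_ge0//.
by have [_ ->] := fD; rewrite ltry.
Qed.

(** A function that is positive on a box cannot vanish almost everywhere there,
    since the box has positive Lebesgue measure. *)
Lemma Dplus_mass_gt0 (A : set (mR * mR)) (a b c d : R) : measurable A ->
  a < b -> c < d -> `]a, b[ `*` `]c, d[ `<=` A `&` [set x | 0 < f x] ->
  (0 < \int[leb2 R]_(x in A) (f x)%:E)%E.
Proof.
move=> mA ab cd sub.
rewrite lt0e integral_ge0 ?andbT; last by move=> x _; rewrite lee_fin Dplus_ge0.
apply/negP => /eqP A0.
have mf : measurable_fun A (EFin \o f).
  by apply/measurable_funTS/measurable_EFinP; exact: Dplus_measurable.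
have : (\int[leb2 R]_(x in A) `|(EFin \o f) x| = 0)%E.
  rewrite -[RHS]A0; apply: eq_integral => x _ /=.
  by rewrite ger0_norm// Dplus_ge0.
move/(ae_eq_integral_abs _ mA mf) => -[N [mN N0 subN]].
have mB : measurable ((`]a, b[ : set mR) `*` (`]c, d[ : set mR)).
  by apply: measurableX; exact: measurable_itv.
have : (leb2 R ((`]a, b[ : set mR) `*` (`]c, d[ : set mR)) = 0)%E.
  apply: (subset_measure0 mB mN _ N0) => x Bx; apply: subN => /= H.
  have [Ax fx] := sub _ Bx.
  by have := H Ax; case=> fx0; move: fx => /=; rewrite fx0 ltxx.
rewrite leb2_rectangle; [|exact: measurable_itv|exact: measurable_itv].
rewrite !lebesgue_measure_itv /= !lte_fin ab cd -!EFinB -EFinM => -[] /eqP.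
by rewrite mulf_eq0 !subr_eq0 !gt_eqF.
Qed.

Lemma Dplus_box x : 0 < f x -> exists2 e, 0 < e &
  forall y, `|x.1 - y.1| < e -> `|x.2 - y.2| < e -> 0 < f y.
Proof.
move=> fx.
have /nbhs_ballP[e /= e0 eO] : nbhs x [set x | 0 < f x].
  by apply: open_nbhs_nbhs; split => //; exact: Dplus_open.
by exists e => // y y1 y2; apply: eO; split.
Qed.

End Dplus.

(** Both marginals are treated at once: the statements below hold for a projection
    [p] known to be one of the two. *)
Definition is_coord (R : realType) (p : R * R -> R) : Prop :=
  p = fst \/ p = snd.

Lemma is_coord_fst (R : realType) : is_coord (@fst R R).
Proof. by left. Qed.

Lemma is_coord_snd (R : realType) : is_coord (@snd R R).
Proof. by right. Qed.

Section Coordinate.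
Context (R : realType) (p : R * R -> R).
Hypothesis pE : is_coord p.
Local Notation mR := (measurableTypeR R).

Lemma measurable_coord : @measurable_fun _ _ (mR * mR)%type R setT p.
Proof.
by case: pE => ->; [exact: measurable_fst|exact: measurable_snd].
Qed.

Lemma measurable_coord_le s : @measurable _ (mR * mR)%type [set x | p x <= s].
Proof.
rewrite (_ : [set x | p x <= s] = setT `&` p @^-1` `]-oo, s]); last first.
  by rewrite setTI; apply/seteqP; split => x /=; rewrite in_itv.
exact: measurable_coord.
Qed.

Lemma coord_null s : leb2 R [set x | p x = s] = 0%E.
Proof.
have mT : @measurable _ mR setT by [].
have m1 : @measurable _ mR [set s] by exact: measurable_set1.
case: pE => ->.
- rewrite (_ : [set x | x.1 = s] = [set s] `*` setT); last first.
    by apply/seteqP; split => x /=; [split|case].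
  by rewrite leb2_rectangle// [X in (X * _)%E]lebesgue_measure_set1 mul0e.
- rewrite (_ : [set x | x.2 = s] = setT `*` [set s]); last first.
    by apply/seteqP; split => x /=; [split|case].
  by rewrite leb2_rectangle// [X in (_ * X)%E]lebesgue_measure_set1 mule0.
Qed.

End Coordinate.

Section JointDensity.
Context (R : realType) d (T : measurableType d) (P : probability T R).
Variables (X1 X2 : {RV P >-> R}) (f : R * R -> R).
Hypotheses (fD : Dplus f) (Pf : has_joint_density P X1 X2 f).
Local Notation mR := (measurableTypeR R).

Lemma measurable_pair_RV :
  @measurable_fun _ _ T (mR * mR)%type setT (fun t => (X1 t, X2 t)).
Proof.
apply: measurable_fun_pair.
  exact: (@measurable_funPT _ _ _ _ X1).
exact: (@measurable_funPT _ _ _ _ X2).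
Qed.

Let XY : {RV P >-> (mR * mR)%type} :=
  HB.pack (fun t => (X1 t, X2 t) : mR * mR)
    (isMeasurableFun.Build _ _ T (mR * mR)%type _ measurable_pair_RV).

Lemma ge0_expectation_density (D : set (mR * mR)) (phi : mR * mR -> \bar R) :
  measurable D -> measurable_fun D phi -> (forall x, D x -> (0 <= phi x)%E) ->
  (\int[P]_(t in [set t | D (X1 t, X2 t)]) phi (X1 t, X2 t) =
   \int[leb2 R]_(x in D) (phi x * (f x)%:E))%E.
Proof.
move=> mD mphi phi0.
rewrite -(@ge0_integral_density _ _ _ (leb2 R) (distribution P XY))//.
- rewrite ge0_integral_pushforward//.
  by move=> x /[!inE]; exact: phi0.
- exact: Dplus_measurable.
- exact: Dplus_ge0.
Qed.

Variables (p : R * R -> R) (X : {RV P >-> R}).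
Hypotheses (pE : is_coord p) (XE : forall t, X t = p (X1 t, X2 t)).

Lemma marginal_cdf_integral s : (marginal_cdf p f s)%:E =
  (\int[leb2 R]_(z in [set z | (p z <= s)%R]) (f z)%:E)%E.
Proof.
have mle := measurable_coord_le pE s.
rewrite /marginal_cdf /Rintegral fineK//.
have := Pf mle; rewrite /joint_law /pushforward => <-.
exact/fin_num_measure/(@measurable_funPTI _ _ _ _ XY).
Qed.

Lemma prob_le_marginal s : P [set t | X t <= s] = (marginal_cdf p f s)%:E.
Proof.
rewrite marginal_cdf_integral -[RHS](Pf (measurable_coord_le pE s)).
by congr (P _); apply/seteqP; split => t /=; rewrite XE.
Qed.

Lemma prob_eq_marginal s : P [set t | X t = s] = 0%E.
Proof.
have meq : @measurable _ (mR * mR)%type [set x | p x = s].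
  rewrite (_ : [set x | p x = s] = setT `&` p @^-1` [set s]); last by rewrite setTI.
  by apply: measurable_coord => //; exact: measurable_set1.
rewrite (_ : [set t | X t = s] = (fun t => (X1 t, X2 t)) @^-1` [set x | p x = s]).
  rewrite [LHS](Pf meq) null_set_integral//; last exact: coord_null.
  by apply/measurable_funTS/measurable_EFinP; exact: Dplus_measurable.
by apply/seteqP; split => t /=; rewrite XE.
Qed.

(** The open quadrants below and above a point of the rectangle both meet the
    rectangle in a box, so each side of the point carries positive mass. *)
Lemma marginal_cdf_interior x : 0 < f x -> 0 < marginal_cdf p f (p x) < 1.
Proof.
move=> fx; have [e e0 eP] := Dplus_box fD fx.
have mle := measurable_coord_le pE (p x).
have FI := marginal_cdf_integral (p x).
have sm (y : R) : y - e < y by rewrite ltrBlDr ltrDl.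
have gr (y : R) : y < y + e by rewrite ltrDl.
apply/andP; split.
  rewrite -lte_fin FI.
  apply: (@Dplus_mass_gt0 _ _ fD _ (x.1 - e) x.1 (x.2 - e) x.2) => //.
  move=> z [] /=; rewrite !in_itv /= => /andP[? ?] /andP[? ?]; split.
    by case: pE => ->; exact: ltW.
  by apply: eP; rewrite ltr_distl; apply/andP; split; lra.
rewrite -subr_gt0 -lte_fin EFinB FI.
have <- : (\int[leb2 R]_x (f x)%:E = 1)%E by case: fD.
rewrite -(setUv [set z | p z <= p x]) ge0_integral_setU//=; last 4 first.
- exact: measurableC.
- by rewrite setUv; apply/measurable_EFinP; exact: Dplus_measurable.
- by move=> z _; rewrite lee_fin Dplus_ge0.
- exact/disj_setPCl.
rewrite -FI addeAC subee// add0e.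
apply: (@Dplus_mass_gt0 _ _ fD _ x.1 (x.1 + e) x.2 (x.2 + e)) => //.
  exact: measurableC.
move=> z [] /=; rewrite !in_itv /= => /andP[? ?] /andP[? ?]; split.
  by case: pE => -> /=; apply/negP; rewrite -ltNge.
by apply: eP; rewrite ltr_distl; apply/andP; split; lra.
Qed.

(** Otherwise all the mass lies strictly on one side of [s], and the rank of [s] is
    0 or 1. *)
Lemma marginal_cdf_support s : 0 < marginal_cdf p f s < 1 ->
  exists z z', [/\ 0 < f z, 0 < f z', p z <= s & s <= p z'].
Proof.
move=> /andP[F0 F1].
have FI := marginal_cdf_integral s.
have f0E z : ~ 0 < f z -> f z = 0.
  move/negP; rewrite -leNgt => fz; apply/eqP.
  by rewrite eq_le fz Dplus_ge0.
have [[z [pz fz]]|H] := pselect (exists z, p z <= s /\ 0 < f z); last first.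
  exfalso; move: F0; rewrite -lte_fin FI integral0_eq ?ltxx// => z pz.
  by rewrite f0E// => fz; apply: H; exists z.
have [[z' [pz' fz']]|H'] := pselect (exists z, s <= p z /\ 0 < f z); last first.
  exfalso; move: F1; rewrite -lte_fin FI.
  suff -> : (\int[leb2 R]_(z in [set z | (p z <= s)%R]) (f z)%:E = 1)%E.
    by rewrite ltxx.
  have [_ <-] := fD; rewrite integral_mkcond; apply: eq_integral => y _.
  rewrite patchE; case: ifPn => //; rewrite notin_setE /= => /negP.
  rewrite -ltNge => /ltW sy.
  by rewrite f0E// => fz'; apply: H'; exists y.
by exists z, z'.
Qed.

End JointDensity.

(** * Kernels evaluated at a uniform rank *)

Section KernelOfRank.
Context (R : realType) d (T : measurableType d) (P : probability T R).
Variables (X : {RV P >-> R}) (F : R -> R) (w : R -> R).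
Hypothesis FE : forall s, P [set t | X t <= s] = (F s)%:E.
Hypothesis noatom : forall s, P [set t | X t = s] = 0%E.
Hypothesis wK : is_kernel w.

Lemma kernel_rank_ge0 s : 0 <= w (F s).
Proof. by case: wK => _ w0 _; apply: w0; exact: (cdf01 FE). Qed.

Lemma measurable_kernel_cdf : measurable_fun setT (w \o F).
Proof.
case: wK => mw _ _.
apply: (@measurable_comp _ _ _ R R R `[0, 1]%classic w setT F) => //.
- by move=> _ [s _ <-]; rewrite /= in_itv /= (cdf01 FE).
- exact: (measurable_cdf FE).
Qed.

Lemma measurable_kernel_rank : measurable_fun setT (w \o F \o X).
Proof. exact: measurableT_comp measurable_kernel_cdf _. Qed.

(** The rank is uniform, so the mean is the total mass of the kernel.  It is what
    makes the integral of [(w (F X) - 1)] over an event a covariance. *)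
Lemma integral_kernel_rank : (\int[P]_t (w (F (X t)))%:E = 1)%E.
Proof. by case: (wK) => mw w0 w1; rewrite (ge0_integral_rank FE noatom). Qed.

Lemma integrable_kernel_rank : P.-integrable setT (EFin \o (w \o F \o X)).
Proof.
apply/integrableP; split; first exact/measurable_EFinP/measurable_kernel_rank.
under eq_integral do rewrite /= ger0_norm ?kernel_rank_ge0//.
by rewrite integral_kernel_rank ltry.
Qed.

Variable Y : {RV P >-> R}.

(** Because [w (F X)] has mean 1, the product of the two means is the probability of
    the event. *)
Lemma gamma_covE s : gamma_cov P w F X Y s =
  fine (\int[P]_(t in [set t | (Y t <= s)%R]) (w (F (X t)))%:E)%E -
  fine (P [set t | Y t <= s]).
Proof.
have mB := measurable_le_RV Y s; set B := [set t | Y t <= s] in mB *.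
pose W := w \o F \o X.
have EWB : (\int[P]_t (EFin \o (W * \1_B)%R) t =
    \int[P]_(t in B) (w (F (X t)))%:E)%E.
  rewrite [RHS]integral_mkcond; apply: eq_integral => t _ /=.
  rewrite patchE -[(W * \1_B) t]/(W t * \1_B t) indicE.
  by case: ifPn => _; rewrite ?mulr1 ?mulr0.
have mWB : measurable_fun setT (W * \1_B).
  by apply: measurable_funM; [exact: measurable_kernel_rank|exact: measurable_indic].
have iWB : P.-integrable setT (EFin \o (W * \1_B)%R).
  apply: (le_integrable _ _ _ integrable_kernel_rank) => //.
    exact/measurable_EFinP.
  move=> t _ /=; rewrite lee_fin normrM ler_piMr//.
  by rewrite indicE; case: (_ \in _); rewrite ?normr1 ?normr0.
have i1 : P.-integrable setT (EFin \o (\1_B : T -> R)).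
  exact: integrable_indic.
rewrite /gamma_cov -/W -/B covarianceE; last 3 first.
- by apply/Lfun1_integrable; exact: integrable_kernel_rank.
- by apply/Lfun1_integrable.
- by apply/Lfun1_integrable.
rewrite expectation_indic// unlock EWB.
rewrite (_ : (\int[P]_t (W t)%:E = 1)%E); last exact: integral_kernel_rank.
rewrite mul1e fineB//; first by rewrite -EWB; exact: integrable_fin_num.
exact: fin_num_measure.
Qed.

(** The law of [X] restricted to an independent event [B] is [P B] times the law of
    [X], that is, it has constant density [P B]. *)
Lemma gamma_cov_indep s : independent_RV P X Y -> gamma_cov P w F X Y s = 0.
Proof.
move=> ind; rewrite gamma_covE.
have mB := measurable_le_RV Y s; set B := [set t | Y t <= s] in mB *.
pose b := fine (P B).
have Pb : P B = b%:E by rewrite /b fineK// fin_num_measure.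
pose PB := mrestr P mB.
have nuE A : measurable A ->
    pushforward PB X A = (\int[distribution P X]_(x in A) b%:E)%E.
  move=> mA; rewrite integral_cst// /distribution /pushforward /PB /mrestr.
  have := ind A `]-oo, s]%classic mA (measurable_itv _).
  rewrite (_ : Y @^-1` _ = B); last by apply/seteqP; split => t /=; rewrite in_itv.
  by rewrite -Pb muleC.
have mw := measurable_kernel_cdf.
have w0 := kernel_rank_ge0.
have b0 : 0 <= b by rewrite fine_ge0.
rewrite (_ : (\int[P]_(t in B) (w (F (X t)))%:E = b%:E)%E); first by rewrite /b subrr.
transitivity (\int[PB]_t (w (F (X t)))%:E)%E.
  rewrite (@ge0_integral_density _ T R P PB (\1_B))//.
  - rewrite [LHS]integral_mkcond; apply: eq_integral => t _.
    by rewrite patchE indicE; case: ifPn => _; rewrite ?mule1 ?mule0.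
  - by move=> A mA; rewrite integral_indic// setIC; exact: erefl.
  - by apply/measurable_EFinP; exact: measurable_kernel_rank.
  - by move=> t _; rewrite lee_fin.
transitivity (\int[pushforward PB X]_x (w (F x))%:E)%E.
  rewrite ge0_integral_pushforward//; first exact/measurable_EFinP.
  by move=> y _; rewrite lee_fin.
rewrite (@ge0_integral_density _ R R (distribution P X) (pushforward PB X)
  (cst b))//; last 2 first.
- exact/measurable_EFinP.
- by move=> y _; rewrite lee_fin.
rewrite /= ge0_integralZr//; last 2 first.
- exact/measurable_EFinP.
- by move=> y _; rewrite lee_fin.
rewrite ge0_integral_pushforward//; last 2 first.
- exact/measurable_EFinP.
- by move=> y _; rewrite lee_fin.
by rewrite integral_kernel_rank mul1e.
Qed.

End KernelOfRank.

(** * The Lie bracket of the coordinate fields *)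

Section DirectionalDerivative.
Context (R : realType) (q : R * R -> R) (w : R -> R) (f h : R * R -> R).
Hypothesis qE : is_coord q.
Hypothesis intf : (leb2 R).-integrable setT (EFin \o f).
Hypothesis inth : (leb2 R).-integrable setT (EFin \o h).

(** The marginal is linear in the density, so along a line of densities it is
    affine and only the scalar function [w] has to be differentiated. *)
Lemma marginal_cdf_along s t :
  marginal_cdf q (fun z => f z + t * h z) s =
  marginal_cdf q f s + t * \int[leb2 R]_(x in [set x | q x <= s]) h x.
Proof.
have mle := measurable_coord_le qE s.
have intfs := integrableS measurableT mle (@subsetT _ _) intf.
have inths := integrableS measurableT mle (@subsetT _ _) inth.
rewrite /marginal_cdf RintegralD//; last first.
  exact: (@integrableZl _ _ _ _ _ mle t _ inths).
by rewrite RintegralZl.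
Qed.

(** The alternative in the hypothesis covers the points outside the rectangle:
    there the rank may be 0 or 1, where [w] need not be differentiable, but the
    field vanishes identically along the line. *)
Lemma is_derive_along x :
  f x = 0 /\ h x = 0 \/ derivable w (marginal_cdf q f (q x)) 1 ->
  is_derive (0 : R) 1 (along (coord_field w q) f h x)
   (derive1 w (marginal_cdf q f (q x)) *
      (\int[leb2 R]_(z in [set z | q z <= q x]) h z) * f x +
    (w (marginal_cdf q f (q x)) - 1) * h x).
Proof.
set c := marginal_cdf q f (q x); set k := Rintegral _ _ _.
have -> : along (coord_field w q) f h x =
    fun t => (w (c + t * k) - 1) * (f x + t * h x).
  by apply/funext => t; rewrite /along /coord_field marginal_cdf_along.
case=> [[-> ->]|dw].
  rewrite !mulr0 addr0.
  under [X in is_derive _ _ X]eq_fun do rewrite mulr0 addr0 mulr0.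
  exact: is_derive_cst.
have dl (a b : R) : is_derive (0 : R) 1 (fun t : R => a + t * b) b.
  have -> : (fun t : R => a + t * b) = cst a \+ b \*: (@id R).
    by apply/funext => t /=; rewrite [t * b]mulrC.
  by apply: is_derive_eq; rewrite scaler1 add0r.
have dwc : is_derive (0 : R) 1 (w \o (fun t => c + t * k)) (derive1 w c * k).
  apply: is_derive1_comp.
  rewrite mul0r addr0; rewrite derive1E; exact: DeriveDef.
pose A := (w \o (fun t : R => c + t * k)) - cst 1.
have dA : is_derive (0 : R) 1 A (derive1 w c * k).
  by apply: is_derive_eq; rewrite subr0.
pose B := fun t : R => f x + t * h x.
have dB : is_derive (0 : R) 1 B (h x) by exact: dl.
have -> : (fun t => (w (c + t * k) - 1) * (f x + t * h x)) = A * B by exact/funext.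
apply: is_derive_eq.
rewrite -[_ *: h x]/((w (c + 0 * k) - 1) * h x).
rewrite -[_ *: (_ * k)]/((f x + 0 * h x) * (derive1 w c * k)) !mul0r !addr0.
by rewrite addrC [f x * _]mulrC.
Qed.

End DirectionalDerivative.

Section Bracket.
Context (R : realType) d (T : measurableType d) (P : probability T R).
Variables (X1 X2 : {RV P >-> R}) (f : R * R -> R) (w : R -> R).
Hypotheses (fD : Dplus f) (Pf : has_joint_density P X1 X2 f).
Hypothesis wK : is_kernel w.
Local Notation mR := (measurableTypeR R).

Section OneField.
Variables (p : R * R -> R) (X : {RV P >-> R}).
Hypotheses (pE : is_coord p) (XE : forall t, X t = p (X1 t, X2 t)).
Let FE := prob_le_marginal Pf pE XE.
Let FA := prob_eq_marginal fD Pf pE XE.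

Lemma measurable_kernel_coord :
  @measurable_fun _ _ (mR * mR)%type R setT (fun x => w (marginal_cdf p f (p x))).
Proof.
apply: (measurableT_comp (measurable_kernel_cdf FE wK)).
exact: measurable_coord.
Qed.

Lemma integral_kernel_coord (D : set (mR * mR)) : measurable D ->
  (\int[leb2 R]_(x in D) (w (marginal_cdf p f (p x)) * f x)%:E =
   \int[P]_(t in [set t | D (X1 t, X2 t)]) (w (marginal_cdf p f (X t)))%:E)%E.
Proof.
move=> mD; under [LHS]eq_integral do rewrite EFinM.
rewrite -(ge0_expectation_density fD Pf)//.
- by apply: eq_integral => t _; rewrite XE.
- by apply/measurable_funTS/measurable_EFinP; exact: measurable_kernel_coord.
- by move=> x _; rewrite lee_fin (kernel_rank_ge0 FE wK).
Qed.

Lemma integrable_kernel_coord : (leb2 R).-integrable setT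
  (EFin \o (fun x => w (marginal_cdf p f (p x)) * f x)).
Proof.
apply/integrableP; split.
  apply/measurable_EFinP; apply: measurable_funM.
    exact: measurable_kernel_coord.
  exact: Dplus_measurable.
under eq_integral => x _.
  rewrite /= ger0_norm; last first.
    by rewrite mulr_ge0 ?Dplus_ge0// (kernel_rank_ge0 FE wK).
  over.
rewrite integral_kernel_coord//.
rewrite (_ : [set t | _] = setT); last exact/seteqP.
by rewrite (integral_kernel_rank FE FA wK) ltry.
Qed.

Lemma coord_fieldE : coord_field w p f =
  (fun x => w (marginal_cdf p f (p x)) * f x - f x).
Proof. by apply/funext => x; rewrite /coord_field mulrBl mul1r. Qed.

Lemma integrable_coord_field : (leb2 R).-integrable setT (EFin \o coord_field w p f).
Proof.
rewrite coord_fieldE.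
exact: (integrableB measurableT integrable_kernel_coord (Dplus_integrable fD)).
Qed.

Variables (q : R * R -> R) (Y : {RV P >-> R}).
Hypotheses (qE : is_coord q) (YE : forall t, Y t = q (X1 t, X2 t)).

(** Moving along the first field shifts the other marginal by the integral of
    [(w (F X) - 1)] over the event [Y <= s], which is a covariance because
    [w (F X)] has mean 1. *)
Lemma integral_coord_field s :
  \int[leb2 R]_(x in [set x | q x <= s]) coord_field w p f x =
  gamma_cov P w (marginal_cdf p f) X Y s.
Proof.
have mle := measurable_coord_le qE s.
rewrite coord_fieldE RintegralB//; last 2 first.
- exact: (integrableS measurableT mle (@subsetT _ _) integrable_kernel_coord).
- exact: (integrableS measurableT mle (@subsetT _ _) (Dplus_integrable fD)).
rewrite (gamma_covE FE FA wK) (prob_le_marginal Pf qE YE) /=.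
rewrite /Rintegral integral_kernel_coord//.
rewrite (_ : [set t | Y t <= s] = [set t | [set x | q x <= s] (X1 t, X2 t)])//.
by apply/seteqP; split => t /=; rewrite YE.
Qed.

End OneField.

Hypothesis dw : forall z, 0 < z < 1 -> derivable w z 1.

Let X1E t : X1 t = fst (X1 t, X2 t). Proof. by []. Qed.
Let X2E t : X2 t = snd (X1 t, X2 t). Proof. by []. Qed.
Let fstE := is_coord_fst R.
Let sndE := is_coord_snd R.

Lemma is_derive_coord_field p q (X Y : {RV P >-> R})
    (pE : is_coord p) (XE : forall t, X t = p (X1 t, X2 t))
    (qE : is_coord q) (YE : forall t, Y t = q (X1 t, X2 t)) x :
  is_derive (0 : R) 1 (along (coord_field w q) f (coord_field w p f) x)
    (derive1 w (marginal_cdf q f (q x)) *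
      gamma_cov P w (marginal_cdf p f) X Y (q x) * f x +
    (w (marginal_cdf q f (q x)) - 1) * coord_field w p f x).
Proof.
rewrite -(integral_coord_field pE XE qE YE).
apply: is_derive_along => //.
- exact: Dplus_integrable.
- exact: (integrable_coord_field pE XE).
have := Dplus_ge0 fD x; rewrite le_eqVlt => /orP[/eqP fx|fx].
  by left; rewrite /coord_field -fx mulr0.
by right; apply: dw; exact: (marginal_cdf_interior fD Pf qE).
Qed.

(** In each derivative the term that differentiates the factor [f] is the product
    [(w (F1 x1) - 1) * (w (F2 x2) - 1) * f x], symmetric in the two fields, so it
    cancels and only the terms that differentiate the ranks survive. *)
Lemma lie_bracket_multiplier x :
  lie_bracket (coord_field w fst) (coord_field w snd) f x =
  multiplier P X1 X2 w f x * f x.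
Proof.
have D2 := is_derive_coord_field fstE X1E sndE X2E x.
have D1 := is_derive_coord_field sndE X2E fstE X1E x.
rewrite /lie_bracket /dir_derive !derive1E (@derive_val _ _ _ _ _ _ _ D2).
rewrite (@derive_val _ _ _ _ _ _ _ D1) /multiplier /coord_field.
by ring.
Qed.

Lemma dir_derivable_snd : dir_derivable (coord_field w snd) f (coord_field w fst f).
Proof. by move=> x; case: (is_derive_coord_field fstE X1E sndE X2E x). Qed.

Lemma dir_derivable_fst : dir_derivable (coord_field w fst) f (coord_field w snd f).
Proof. by move=> x; case: (is_derive_coord_field sndE X2E fstE X1E x). Qed.

Lemma multiplier_indep x : independent_RV P X1 X2 -> multiplier P X1 X2 w f x = 0.
Proof.
move=> ind.
have ind' : independent_RV P X2 X1.
  by move=> A B mA mB; rewrite setIC ind// muleC.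
rewrite /multiplier.
rewrite (gamma_cov_indep (prob_le_marginal Pf fstE X1E)
  (prob_eq_marginal fD Pf fstE X1E) wK)//.
rewrite (gamma_cov_indep (prob_le_marginal Pf sndE X2E)
  (prob_eq_marginal fD Pf sndE X2E) wK)//.
by rewrite !mulr0 subrr.
Qed.

End Bracket.

(** * Dependence on the copula alone *)

Section Copula.
Context (R : realType) d (T : measurableType d) (P : probability T R).
Variables (X1 X2 : {RV P >-> R}) (f : R * R -> R) (w : R -> R).
Hypotheses (fD : Dplus f) (Pf : has_joint_density P X1 X2 f).
Hypothesis wK : is_kernel w.
Local Notation mR := (measurableTypeR R).
Local Notation F1 := (marginal_cdf fst f).
Local Notation F2 := (marginal_cdf snd f).
Let X1E t : X1 t = fst (X1 t, X2 t). Proof. by []. Qed.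
Let X2E t : X2 t = snd (X1 t, X2 t). Proof. by []. Qed.
Let fstE := is_coord_fst R.
Let sndE := is_coord_snd R.

Lemma measurable_rank_pair :
  @measurable_fun _ _ T (mR * mR)%type setT (fun t => (F1 (X1 t), F2 (X2 t))).
Proof.
apply: measurable_fun_pair.
  exact: (measurable_cdf_RV (prob_le_marginal Pf fstE X1E)).
exact: (measurable_cdf_RV (prob_le_marginal Pf sndE X2E)).
Qed.

Definition rank_pair : {RV P >-> (mR * mR)%type} :=
  HB.pack (fun t => (F1 (X1 t), F2 (X2 t)) : mR * mR)
    (isMeasurableFun.Build _ _ T (mR * mR)%type _ measurable_rank_pair).

(** The event [Y <= s] may be replaced by the event that the rank of [Y] is at most
    the rank of [s], and the integral then depends on the law of the ranks and on
    the rank of [s] only.  The integration set is confined to the unit interval in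
    the rank of [X] because [w] is measurable and nonnegative only there. *)
Lemma gamma_cov_copula (p q : R * R -> R) (X Y : {RV P >-> R}) s :
  is_coord p -> is_coord q ->
  (forall t, X t = p (X1 t, X2 t)) -> (forall t, Y t = q (X1 t, X2 t)) ->
  gamma_cov P w (marginal_cdf p f) X Y s =
  fine (\int[distribution P rank_pair]_(x in
     [set x : mR * mR | (0 <= p x <= 1)%R /\ (q x <= marginal_cdf q f s)%R]) (w (p x))%:E)%E
  - marginal_cdf q f s.
Proof.
move=> pE qE XE YE.
have FE := prob_le_marginal Pf pE XE; have FA := prob_eq_marginal fD Pf pE XE.
have GE := prob_le_marginal Pf qE YE; have GA := prob_eq_marginal fD Pf qE YE.
rewrite (gamma_covE FE FA wK) GE /=; congr (fine _ - _).
rewrite (ge0_integral_le_rank GE GA); last 2 first.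
- by apply/measurable_EFinP; exact: (measurable_kernel_rank FE wK).
- by move=> t; rewrite lee_fin (kernel_rank_ge0 FE wK).
have rE r Z : is_coord r -> (forall t, Z t = r (X1 t, X2 t)) ->
    forall t, r (rank_pair t) = marginal_cdf r f (Z t).
  by move=> [->|->] ZE t; rewrite ZE.
have mp : @measurable_fun _ _ (mR * mR)%type R setT p := measurable_coord pE.
have mD : @measurable _ (mR * mR)%type
    [set x | 0 <= p x <= 1 /\ q x <= marginal_cdf q f s].
  apply: measurableI; last exact: measurable_coord_le.
  rewrite [X in measurable X](_ : _ = setT `&` p @^-1` `[0, 1]).
    by apply: mp => //; exact: measurable_itv.
  by rewrite setTI; apply/seteqP; split => x /=; rewrite in_itv.
case: (wK) => mw w0 _.
rewrite ge0_integral_pushforward//; last 2 first.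
- apply/measurable_EFinP.
  apply: (@measurable_comp _ _ _ (mR * mR)%type R R `[0, 1]%classic w) => //.
  + by move=> _ [x /= [x01 _] <-]; rewrite in_itv.
  + exact: measurable_funTS.
- by move=> x; rewrite inE /= => -[x01 _]; rewrite lee_fin w0.
rewrite (_ : rank_pair @^-1` _ =
  [set t | (marginal_cdf q f (Y t) <= marginal_cdf q f s)%R]); last first.
  apply/seteqP; split => t /=; rewrite (rE p X)// (rE q Y)//; first by case.
  by move=> ?; split => //; exact: (cdf01 FE).
by apply: eq_integral => t _ /=; rewrite -(rE p X).
Qed.

End Copula.

Lemma multiplier_copula (R : realType) (w : R -> R) (d d' : measure_display)
    (T : measurableType d) (T' : measurableType d')
    (P : probability T R) (P' : probability T' R)
    (X1 X2 : {RV P >-> R}) (Y1 Y2 : {RV P' >-> R}) (f g : R * R -> R) :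
  is_kernel w ->
  Dplus f -> has_joint_density P X1 X2 f ->
  Dplus g -> has_joint_density P' Y1 Y2 g ->
  (forall A : set (measurableTypeR R * measurableTypeR R), measurable A ->
     copula P X1 X2 f A = copula P' Y1 Y2 g A) ->
  forall x y : R * R,
    marginal_cdf fst f x.1 = marginal_cdf fst g y.1 ->
    marginal_cdf snd f x.2 = marginal_cdf snd g y.2 ->
    multiplier P X1 X2 w f x = multiplier P' Y1 Y2 w g y.
Proof.
move=> wK fD Pf gD Pg copE x y xy1 xy2.
have fstE := is_coord_fst R; have sndE := is_coord_snd R.
rewrite /multiplier.
rewrite !(gamma_cov_copula fD Pf wK _ fstE sndE)//.
rewrite !(gamma_cov_copula fD Pf wK _ sndE fstE)//.
rewrite !(gamma_cov_copula gD Pg wK _ fstE sndE)//.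
rewrite !(gamma_cov_copula gD Pg wK _ sndE fstE)//.
rewrite xy1 xy2.
have muE D phi : (\int[distribution P (rank_pair Pf)]_(x in D) phi x =
    \int[distribution P' (rank_pair Pg)]_(x in D) phi x)%E.
  by apply: eq_measure_integral => A mA _; exact: copE.
by rewrite !muE.
Qed.

(** * Trigonometric moments determine the law of a rank *)

Section StepApproximation.
Context (R : realType).

Lemma ge_expr_1B (x : R) n : 0 <= x <= 1 -> 1 - n%:R * x <= (1 - x) ^+ n.
Proof.
move=> /andP[x0 x1]; elim: n => [|n IH]; first by rewrite mul0r subr0 expr0.
rewrite exprS; apply: le_trans (ler_wpM2l _ IH); last by rewrite subr_ge0.
rewrite -subr_ge0 -natr1 (_ : _ - _ = n%:R * x ^+ 2); last by ring.
by rewrite mulr_ge0// exprn_ge0.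
Qed.

Lemma ge_expr_1D (x : R) n : 0 <= x -> 1 + n%:R * x <= (1 + x) ^+ n.
Proof.
move=> x0; elim: n => [|n IH]; first by rewrite mul0r addr0 expr0.
rewrite exprS; apply: le_trans (ler_wpM2l _ IH); last by rewrite addr_ge0.
rewrite -subr_ge0 -natr1 (_ : _ - _ = n%:R * x ^+ 2); last by ring.
by rewrite mulr_ge0// exprn_ge0.
Qed.

(** Polynomials in [t] that tend to the indicator of [t < 1/2] on the unit interval
    away from 1/2; they are used in elementary proofs of the Stone-Weierstrass
    theorem. *)
Definition step n (t : R) : R := (1 - t ^+ n) ^+ (2 ^ n).

Lemma step01 n t : 0 <= t <= 1 -> 0 <= step n t <= 1.
Proof.
move=> /andP[t0 t1]; have tn1 : t ^+ n <= 1 by exact: exprn_ile1.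
have tn0 : 0 <= t ^+ n by exact: exprn_ge0.
apply/andP; split; first by rewrite exprn_ge0// subr_ge0.
by apply: exprn_ile1; rewrite ?subr_ge0// lerBlDr lerDl.
Qed.

(** By Bernoulli's inequality, [step n t >= 1 - (2 * t) ^+ n]. *)
Lemma cvg_step_lt t : 0 <= t < 1/2 -> step n t @[n --> \oo] --> (1 : R).
Proof.
move=> /andP[t0 t1].
apply: (@squeeze_cvgr _ _ _ _ (fun n => 1 - (2 * t) ^+ n) (cst 1)).
- near=> n; apply/andP; split; last by have /andP[] := @step01 n t ltac:(lra).
  rewrite exprMn -natrX; apply: ge_expr_1B.
  by rewrite exprn_ge0//= exprn_ile1//; lra.
- rewrite -[X in _ --> X](subr0 (1 : R)); apply: cvgB; first exact: cvg_cst.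
  by apply: cvg_expr; rewrite ger0_norm; lra.
- exact: cvg_cst.
Unshelve. all: by end_near. Qed.

(** Since [(1 - u) * (1 + u) <= 1] for [u = t ^+ n], Bernoulli's inequality for
    [1 + u] gives [step n t <= (2 * t) ^- n]. *)
Lemma cvg_step_gt t : 1/2 < t <= 1 -> step n t @[n --> \oo] --> (0 : R).
Proof.
move=> /andP[t0 t1].
apply: (@squeeze_cvgr _ _ _ _ (cst 0) (fun n => (2 * t)^-1 ^+ n)).
- near=> n; have /andP[s0 _] := @step01 n t ltac:(lra); rewrite s0 /=.
  have tn0 : 0 <= t ^+ n by rewrite exprn_ge0//; lra.
  have tn1 : t ^+ n <= 1 by apply: exprn_ile1; lra.
  rewrite exprVn -[leRHS]mul1r ler_pdivlMr; last by rewrite exprn_gt0; lra.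
  apply: (@le_trans _ _ (step n t * (1 + t ^+ n) ^+ (2 ^ n))).
    rewrite ler_wpM2l//; apply: le_trans (ge_expr_1D _ tn0).
    by rewrite exprMn -natrX lerDr.
  rewrite -exprMn (_ : _ * _ = 1 - (t ^+ n) ^+ 2); last by ring.
  apply: exprn_ile1; first by rewrite subr_ge0; exact: exprn_ile1.
  by rewrite lerBlDr lerDl exprn_ge0.
- exact: cvg_cst.
- by apply: cvg_expr; rewrite ger0_norm ?invr_ge0 ?invf_lt1; lra.
Unshelve. all: by end_near. Qed.

End StepApproximation.

Section TrigDecorrelation.
Context (R : realType) d (T : measurableType d) (P : probability T R).
Variables (U : T -> R) (B : set T).
Hypothesis mU : measurable_fun setT U.
Hypothesis mB : measurable B.

(** Uncorrelated with the event [B] after substitution of [U].  Boundedness and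
    measurability are included so that the class is closed under linear
    combinations without integrability side conditions. *)
Definition decorrelated (phi : R -> R) : Prop :=
  [/\ measurable_fun setT phi, (exists M, forall x, `|phi x| <= M) &
   \int[P]_(t in B) phi (U t) = fine (P B) * \int[P]_t phi (U t)].

Lemma integrable_bounded (phi : R -> R) (D : set T) : measurable D ->
  measurable_fun setT phi -> (exists M, forall x, `|phi x| <= M) ->
  P.-integrable D (EFin \o (phi \o U)).
Proof.
move=> mD mphi [M phiM].
apply: measurable_bounded_integrable => //.
- by rewrite (le_lt_trans (probability_le1 _ _))// ltry.
- by apply: measurable_funTS; apply: measurableT_comp.
- exists M; split; first exact: num_real.
  by move=> N MN x _ /=; exact: le_trans (phiM _) (ltW MN).
Qed.

Lemma decorrelated_cst c : decorrelated (cst c).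
Proof.
split => //; first by exists `|c|.
have PT : fine (P [set: T]) = 1 by rewrite probability_setT.
rewrite !Rintegral_cst//; transitivity (fine (P B) * (c * 1)).
  by rewrite mulr1 mulrC.
by rewrite -PT.
Qed.

Lemma decorrelatedD phi psi :
  decorrelated phi -> decorrelated psi -> decorrelated (fun x => phi x + psi x).
Proof.
move=> [m1 b1 e1] [m2 b2 e2]; split; first exact: measurable_funD.
  case: b1 b2 => M1 b1 [M2 b2]; exists (M1 + M2) => x.
  by apply: le_trans (ler_normD _ _) _; exact: lerD.
rewrite !RintegralD//; try exact: integrable_bounded.
by rewrite e1 e2 mulrDr.
Qed.

Lemma decorrelatedZ c phi : decorrelated phi -> decorrelated (fun x => c * phi x).
Proof.
move=> [m1 b1 e1]; split; first exact: measurable_funM.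
  by case: b1 => M b1; exists (`|c| * M) => x; rewrite normrM ler_wpM2l.
rewrite !RintegralZl//; try exact: integrable_bounded.
by rewrite e1 mulrCA.
Qed.

Hypothesis cosU : forall k, (0 < k)%N ->
  \int[P]_(t in B) cos (k%:R * (2 * pi) * U t) =
  fine (P B) * \int[P]_t cos (k%:R * (2 * pi) * U t).
Hypothesis sinU : forall k, (0 < k)%N ->
  \int[P]_(t in B) sin (k%:R * (2 * pi) * U t) =
  fine (P B) * \int[P]_t sin (k%:R * (2 * pi) * U t).

Local Notation theta c x := (2 * pi * (x - c)).

Lemma decorrelated_cos (c : R) k : decorrelated (fun x => cos (k%:R * theta c x)).
Proof.
have [->|k0] := posnP k.
  rewrite (_ : (fun _ => _) = cst 1); first exact: decorrelated_cst.
  by apply/funext => x; rewrite mul0r cos0.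
rewrite (_ : (fun _ => _) = fun x =>
   cos (k%:R * (2 * pi) * c) * cos (k%:R * (2 * pi) * x) +
   sin (k%:R * (2 * pi) * c) * sin (k%:R * (2 * pi) * x)).
  have ml : measurable_fun setT (fun x : R => k%:R * (2 * pi) * x).
    exact: measurable_funM.
  apply: decorrelatedD; apply: decorrelatedZ; split.
  - apply: measurableT_comp ml.
    by apply: continuous_measurable_fun; exact: continuous_cos.
  - by exists 1 => x; rewrite ler_norml cos_geN1 cos_le1.
  - exact: cosU.
  - apply: measurableT_comp ml.
    by apply: continuous_measurable_fun; exact: continuous_sin.
  - by exists 1 => x; rewrite ler_norml sin_geN1 sin_le1.
  - exact: sinU.
apply/funext => x; rewrite mulrA mulrBr cosB.
by ring.
Qed.

(** The extra factor [cos (k * theta)] makes the induction on the polynomial go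
    through: multiplication by [cos theta] turns it into the half-sum of
    [cos ((k + 1) * theta)] and [cos ((k - 1) * theta)]. *)
Lemma decorrelated_horner (c : R) (p : {poly R}) k :
  decorrelated (fun x => p.[cos (theta c x)] * cos (k%:R * theta c x)).
Proof.
move: p k; apply: poly_ind => [k|p a IH k].
  rewrite (_ : (fun _ => _) = cst 0); first exact: decorrelated_cst.
  by apply/funext => x; rewrite horner0 mul0r.
(* For k = 0 the frequency k - 1 is replaced by 1, as cosine is even. *)
rewrite (_ : (fun _ => _) = fun x =>
    (1/2 * (p.[cos (theta c x)] * cos (k.+1%:R * theta c x)) +
     1/2 * (p.[cos (theta c x)] *
       cos ((if k is k'.+1 then k' else 1)%:R * theta c x))) +
    a * cos (k%:R * theta c x)).
  apply: decorrelatedD; last exact/decorrelatedZ/decorrelated_cos.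
  by apply: decorrelatedD; exact/decorrelatedZ/IH.
apply/funext => x; rewrite hornerMXaddC.
case: k => [|k]; first by rewrite mul0r cos0 !mul1r; field.
set y := theta c x; set z := k.+1%:R * y.
rewrite (_ : k.+2%:R * y = z + y); last by rewrite -natr1 mulrDl mul1r.
rewrite (_ : k%:R * y = z - y); last by rewrite /z -natr1 mulrDl mul1r addrK.
by rewrite cosB cosD; field.
Qed.

Hypothesis U01 : forall t, 0 <= U t <= 1.

(** The arc [0 < x < a] is where an affine function of [cos (2 * pi * (x - a / 2))]
    is below 1/2.  Composing it with [step n] gives polynomials in that cosine,
    which are decorrelated from [B] and tend boundedly to the indicator of the
    arc; dominated convergence passes to the limit.  The three levels where the
    limit may fail are null by hypothesis. *)
Lemma trig_decorrelation_indep a : 0 <= a <= 1 ->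
  P [set t | U t = 0] = 0%E -> P [set t | U t = 1] = 0%E ->
  P [set t | U t = a] = 0%E ->
  P ([set t | U t < a] `&` B) = (P [set t | (U t < a)%R] * P B)%E.
Proof.
move=> a01 U0 U1 Ua.
pose s (x : R) := 1/2 + 1/4 * (cos (pi * a) - cos (theta (a / 2) x)).
(* The product form shows the sign of [s x - 1/2] on either side of [a]. *)
have sE x : s x = 1/2 + 1/2 * (sin (pi * x) * sin (pi * (x - a))).
  rewrite /s; congr (_ + _).
  rewrite (_ : pi * a = pi * x - pi * (x - a)); last by ring.
  rewrite (_ : theta (a / 2) x = pi * x + pi * (x - a)); last by field.
  by rewrite cosB cosD; field.
have s01 x : 0 <= s x <= 1.
  rewrite /s; have := cos_geN1 (pi * a); have := cos_le1 (pi * a).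
  have := cos_geN1 (theta (a / 2) x); have := cos_le1 (theta (a / 2) x).
  by move=> *; apply/andP; split; lra.
have dec n : decorrelated (step n \o s).
  pose q : {poly R} := (1/2 + 1/4 * cos (pi * a))%:P - (1/4) *: 'X.
  have := decorrelated_horner (a / 2) ((1 - q ^+ n) ^+ (2 ^ n)) 0.
  rewrite (_ : (fun _ => _) = step n \o s)//.
  apply/funext => x; rewrite mul0r cos0 mulr1 /= /step !hornerE.
  by congr ((1 - _ ^+ _) ^+ _); rewrite /s; ring.
have sin0 (y : R) : 0 < y < 1 -> 0 < sin (pi * y).
  move=> /andP[y0 y1]; apply: sin_gt0_pi.
  by rewrite mulr_gt0 ?pi_gt0//= gtr_pMr ?pi_gt0.
have cvs (x : R) : 0 <= x <= 1 -> x != 0 -> x != 1 -> x != a ->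
    step n (s x) @[n --> \oo] --> (\1_[set y | y < a] x : R).
  move=> /andP[]; rewrite !le_eqVlt => /orP[/eqP <-|x0]; first by rewrite eqxx.
  move=> /orP[/eqP ->|x1]; first by rewrite eqxx.
  move=> _ _ xa; have sx := sin0 x ltac:(lra).
  have [s0 s1] := andP (s01 x).
  case: (ltgtP x a) xa => // xa _.
  - rewrite indicE mem_set//; apply: cvg_step_lt; rewrite s0 /= sE.
    have := sin0 (a - x) ltac:(lra); rewrite -opprB mulrN sinN => sxa.
    by rewrite gtrDl pmulr_rlt0// pmulr_rlt0//; lra.
  - rewrite indicE memNset /=; last by move=> /lt_trans/(_ xa); rewrite ltxx.
    apply: cvg_step_gt; rewrite s1 andbT sE ltrDl.
    by rewrite mulr_gt0// mulr_gt0// sin0//; lra.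
have mlt : measurable [set t | U t < a].
  rewrite (_ : [set t | U t < a] = setT `&` U @^-1` `]-oo, a[).
    by apply: mU => //; exact: measurable_itv.
  by rewrite setTI; apply/seteqP; split => t /=; rewrite in_itv.
have meq u : measurable [set t | U t = u].
  rewrite (_ : [set t | U t = u] = setT `&` U @^-1` [set u]); last by rewrite setTI.
  by apply: mU => //; exact: measurable_set1.
have lim D : measurable D ->
    \int[P]_(t in D) step n (s (U t)) @[n --> \oo] --> fine (P ([set t | U t < a] `&` D)).
  move=> mD; have mn n : measurable_fun setT (step n \o s \o U).
    by case: (dec n) => m _ _; exact: measurableT_comp.
  have := @dominated_convergence _ T R P D mD
    (fun n t => (step n (s (U t)))%:E) (fun t => (\1_[set t | U t < a] t)%:E)
    (cst 1%E).
  case.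
  - by move=> n; apply/measurable_EFinP/measurable_funTS; exact: mn.
  - by apply/measurable_EFinP/measurable_funTS; exact: measurable_indic.
  - exists ([set t | U t = 0] `|` [set t | U t = 1] `|` [set t | U t = a]); split.
    + by apply: measurableU => //; exact: measurableU.
    + by rewrite null_set_setU ?null_set_setU//; exact: measurableU.
    + move=> t /= H; have [u0|u0] := eqVneq (U t) 0; first by left; left.
      have [u1|u1] := eqVneq (U t) 1; first by left; right.
      have [ua|ua] := eqVneq (U t) a; first by right.
      exfalso; apply: H => _; apply: cvg_EFin; first by near=> n.
      exact: cvs.
  - by apply: finite_measure_integrable_cst.
  - apply/aeW => t n _ /=; rewrite lee_fin.
    by have /andP[s0 s1] := @step01 _ n _ (s01 (U t)); rewrite ger0_norm.
  move=> _ _; rewrite integral_indic// => H.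
  apply: fine_cvg; rewrite fineK ?fin_num_measure//; exact: measurableI.
have PltT := lim setT measurableT; rewrite setIT in PltT.
have PltB := lim B mB.
have PltM := cvgM (@cvg_cst _ (fine (P B)) _ \oo _) PltT.
have H : fine (P ([set t | U t < a] `&` B)) = fine (P B) * fine (P [set t | U t < a]).
  apply: (cvg_unique _ PltB) => //.
  rewrite (_ : (fun n => _) = (fun n => fine (P B) * \int[P]_t step n (s (U t)))).
    exact: PltM.
  by apply/funext => n; case: (dec n).
have mltB : measurable ([set t | U t < a] `&` B) by exact: measurableI.
rewrite -[LHS]fineK ?fin_num_measure// H EFinM !fineK ?fin_num_measure//.
by rewrite muleC.
Unshelve. all: by end_near. Qed.

End TrigDecorrelation.

(** * Independence from the joint distribution function *)

Section RayIndependence.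
Context (R : realType) d (T : measurableType d) (P : probability T R).

(** Both sides are finite measures in [A] that agree on rays. *)
Lemma indep_event_of_rays (X : {RV P >-> R}) (B : set T) : measurable B ->
  (forall r, P ([set t | X t <= r] `&` B) = (P [set t | (X t <= r)%R] * P B)%E) ->
  forall A : set R, measurable A -> P (X @^-1` A `&` B) = (P (X @^-1` A) * P B)%E.
Proof.
move=> mB rays A mA.
pose X' : {RV P >-> measurableTypeR R} :=
  HB.pack (X : T -> measurableTypeR R)
    (isMeasurableFun.Build _ _ T (measurableTypeR R) X (@measurable_funPT _ _ _ _ X)).
pose b := fine (P B).
have b0 : 0 <= b by rewrite fine_ge0.
have Pb : P B = b%:E by rewrite /b fineK// fin_num_measure.
have rE r : X @^-1` `]-oo, r] = [set t | X t <= r].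
  by apply/seteqP; split => t /=; rewrite in_itv.
have H := @eq_measure_of_rays R (pushforward (mrestr P mB) X')
  (mscale (NngNum b0) (distribution P X')).
have := H (@measurable_funPT _ _ _ _ X') _ _ A mA.
rewrite /mscale /= /mrestr /distribution /pushforward /= => ->.
- by rewrite muleC Pb.
- by move=> r; rewrite rE rays muleC Pb.
- move=> r; rewrite (@le_lt_trans _ _ (P B))//; last by rewrite Pb ltry.
  apply: le_measure; rewrite ?inE//; apply: measurableI => //.
  rewrite rE; exact: measurable_le_RV.
Qed.

(** The preceding lemma is used in each variable in turn: for [X] against a ray of
    [Y], then for [Y] against an arbitrary event on [X]. *)
Lemma indep_of_rays (X Y : {RV P >-> R}) :
  (forall r s, P ([set t | X t <= r] `&` [set t | Y t <= s]) =
    (P [set t | (X t <= r)%R] * P [set t | (Y t <= s)%R])%E) ->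
  independent_RV P X Y.
Proof.
move=> rays A B mA mB.
have mXA : measurable (X @^-1` A) by exact: measurable_funPTI.
rewrite setIC muleC; apply: indep_event_of_rays => // s.
rewrite setIC muleC; apply: indep_event_of_rays => //.
exact: measurable_le_RV.
Qed.

Lemma prob_eq_mod_null (C D N : set T) : measurable C -> measurable D ->
  measurable N -> C `<=` D -> D `<=` C `|` N -> P N = 0%E -> P D = P C.
Proof.
move=> mC mD mN CD DC N0; apply/eqP; rewrite eq_le; apply/andP; split.
  rewrite -[leRHS]adde0 -N0.
  apply: le_trans (measureU2 _ mC mN).
  by apply: le_measure; rewrite ?inE//; exact: measurableU.
by apply: le_measure; rewrite ?inE.
Qed.

End RayIndependence.

(** * The phase-shifted kernels and the converse *)

Section PhaseKernel.
Context (R : realType).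
Variables (k : nat) (alpha : R).
Local Notation om := (k%:R * (2 * pi) : R).

Lemma phase_kernelE z : phase_kernel k alpha z = 1 - cos (om * (z + alpha)).
Proof.
rewrite /phase_kernel (_ : om * (z + alpha) = k%:R * pi * (z + alpha) + k%:R * pi * (z + alpha)).
  by rewrite cosD -!expr2 cos2sin2; ring.
by ring.
Qed.

Let is_derive_phase z : is_derive z (1 : R) (fun z => om * (z + alpha)) om.
Proof.
rewrite (_ : (fun z => _) = om \*: (id \+ cst alpha))//.
by apply: is_derive_eq; rewrite addr0 [_ *: _]mulr1.
Qed.

Lemma is_derive_phase_kernel z :
  is_derive z (1 : R) (phase_kernel k alpha) (om * sin (om * (z + alpha))).
Proof.
rewrite (_ : phase_kernel k alpha = cst 1 - (cos \o (fun z => om * (z + alpha)))).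
  have dl := is_derive_phase z.
  have dc : is_derive z (1 : R) (cos \o (fun z => om * (z + alpha)))
    (- sin (om * (z + alpha)) * om) by exact: is_derive1_comp.
  by apply: is_derive_eq; rewrite sub0r mulNr opprK mulrC.
by apply/funext => y; rewrite phase_kernelE.
Qed.

Hypothesis k0 : (0 < k)%N.
Let om0 : 0 < om.
Proof. by rewrite !mulr_gt0 ?ltr0n ?pi_gt0. Qed.

Lemma phase_kernel_is_kernel : is_kernel (phase_kernel k alpha).
Proof.
have cw : continuous (phase_kernel k alpha).
  move=> z; apply/differentiable_continuous/derivable1_diffP.
  by case: (is_derive_phase_kernel z).
split.
- by apply: measurable_funTS; exact: continuous_measurable_fun.
- by move=> z _; rewrite mulr_ge0// sqr_ge0.
pose Phi := fun z : R => z - om^-1 * sin (om * (z + alpha)).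
have dPhi z : is_derive z (1 : R) Phi (phase_kernel k alpha z).
  rewrite phase_kernelE.
  have dl := is_derive_phase z.
  have dc : is_derive z (1 : R) (sin \o (fun z => om * (z + alpha)))
    (cos (om * (z + alpha)) * om) by exact: is_derive1_comp.
  rewrite (_ : Phi = id - om^-1 \*: (sin \o (fun z => om * (z + alpha)))).
    apply: is_derive_eq.
    by rewrite -[_ *: _]/(_ * _) [cos _ * _]mulrC mulKf// gt_eqF.
  by [].
have cPhi : continuous Phi.
  by move=> z; apply/differentiable_continuous/derivable1_diffP; case: (dPhi z).
rewrite (@continuous_FTC2 _ _ Phi)//.
- rewrite -EFinB /Phi !add0r (_ : om * (1 + alpha) = om * alpha + (pi *+ 2) *+ k).
    by rewrite (periodicn (@sinD2pi R)) opprK subrK.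
  by rewrite -mulr_natl -[pi *+ 2]mulr_natl; ring.
- exact: continuous_subspaceT.
- split; first by move=> z _; case: (dPhi z).
  + by apply: cvg_at_right_filter; exact: cPhi.
  + by apply: cvg_at_left_filter; exact: cPhi.
- by move=> z _; rewrite derive1E; exact: derive_val.
Qed.

End PhaseKernel.

(** Here [C] and [S] are the cosine and sine moments, and the three equations come
    from the phases 0, 1/4 and 1/8 of a period.  The first two give [C = S = 0]
    unless [sin psi] or [cos psi] vanishes; then one moment is known to be zero and
    the third equation gives the other. *)
Lemma trig_factor_vanish (R : realType) (psi C S : R) :
  sin psi * C = 0 ->
  sin (psi + pi / 2) * S = 0 ->
  sin (psi + pi / 4) * (cos (pi / 4) * C - sin (pi / 4) * S) = 0 ->
  C = 0 /\ S = 0.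
Proof.
have pi0 := pi_gt0 R.
have c0 : cos (pi / 4) != 0 :> R by rewrite gt_eqF// cos_gt0_pihalf//; lra.
have s0 : sin (pi / 4) != 0 :> R by rewrite gt_eqF// sin_gt0_pi//; lra.
have cs := cos2Dsin2 psi.
rewrite sinDpihalf sinD => /eqP; rewrite mulf_eq0 => /orP[/eqP sp|/eqP ->].
  have cp : cos psi != 0.
    by apply/eqP => cp; move: cs; rewrite cp sp expr0n addr0 => /eqP; rewrite eq_sym oner_eq0.
  move/eqP; rewrite mulf_eq0 (negbTE cp) => /eqP ->.
  rewrite sp mul0r add0r mulr0 subr0 => /eqP.
  by rewrite !mulf_eq0 (negbTE cp) (negbTE c0) (negbTE s0) => /eqP.
move=> /eqP; rewrite mulf_eq0 => /orP[/eqP cp|/eqP ->//].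
have sp : sin psi != 0.
  by apply/eqP => sp; move: cs; rewrite cp sp expr0n addr0 => /eqP; rewrite eq_sym oner_eq0.
rewrite cp mul0r addr0 mulr0 sub0r => /eqP.
by rewrite !mulf_eq0 oppr_eq0 mulf_eq0 (negbTE sp) (negbTE c0) (negbTE s0) => /eqP.
Qed.

Section Converse.
Context (R : realType) d (T : measurableType d) (P : probability T R).
Variables (X1 X2 : {RV P >-> R}) (f : R * R -> R).
Hypotheses (fD : Dplus f) (Pf : has_joint_density P X1 X2 f).
Let X1E t : X1 t = fst (X1 t, X2 t). Proof. by []. Qed.
Let X2E t : X2 t = snd (X1 t, X2 t). Proof. by []. Qed.
Let fstE := is_coord_fst R.
Let sndE := is_coord_snd R.
Local Notation F1 := (marginal_cdf fst f).
Local Notation F2 := (marginal_cdf snd f).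
Let FE := prob_le_marginal Pf fstE X1E.
Let FA := prob_eq_marginal fD Pf fstE X1E.
Let GE := prob_le_marginal Pf sndE X2E.
Let GA := prob_eq_marginal fD Pf sndE X2E.
Local Notation U := (F1 \o X1).

Let mU : measurable_fun setT U. Proof. exact: (measurable_cdf_RV FE). Qed.

(** This is where the support has to be a rectangle: interior marginal ranks put
    each coordinate in its own interval, hence the point in the product. *)
Lemma Dplus_gt0_of_ranks x1 x2 :
  0 < F1 x1 < 1 -> 0 < F2 x2 < 1 -> 0 < f (x1, x2).
Proof.
move=> /(marginal_cdf_support fD Pf fstE) [z1 [z1' [p1 p1' l1 l1']]].
move=> /(marginal_cdf_support fD Pf sndE) [z2 [z2' [p2 p2' l2 l2']]].
have [[a [b [_ fpos f0]]] _] := fD.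
have Q z : 0 < f z -> open_rectangle a b z.
  by move=> fz; apply: contrapT => /f0 fz0; move: fz; rewrite fz0 ltxx.
have [/andP[q1 _] _] := Q _ p1; have [/andP[_ q1'] _] := Q _ p1'.
have [_ /andP[q2 _]] := Q _ p2; have [_ /andP[_ q2']] := Q _ p2'.
apply: fpos; split => /=; apply/andP; split.
- by apply: lt_le_trans q1 _; rewrite lee_fin.
- by apply: le_lt_trans q1'; rewrite lee_fin.
- by apply: lt_le_trans q2 _; rewrite lee_fin.
- by apply: le_lt_trans q2'; rewrite lee_fin.
Qed.

Local Notation C D k alpha :=
  (\int[P]_(t in D) cos (k%:R * (2 * pi) * (U t + alpha))).
Local Notation S D k :=
  (\int[P]_(t in D) sin (k%:R * (2 * pi) * U t)).

Let bounded_int (phi : R -> R) D : measurable D -> continuous phi ->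
  (forall x, `|phi x| <= 1) -> P.-integrable D (EFin \o (phi \o U)).
Proof.
move=> mD cphi phi1; apply: (integrable_bounded P mU mD).
  exact: continuous_measurable_fun.
by exists 1.
Qed.

Let cos_cont (a b : R) : continuous (fun x : R => cos (a * (x + b))).
Proof.
move=> x; apply: continuous_comp; last exact: continuous_cos.
by apply: cvgM; [exact: cvg_cst|apply: cvgD; [exact: cvg_id|exact: cvg_cst]].
Qed.

Let sin_cont (a : R) : continuous (fun x : R => sin (a * x)).
Proof.
move=> x; apply: continuous_comp; last exact: continuous_sin.
by apply: cvgM; [exact: cvg_cst|exact: cvg_id].
Qed.

Lemma cos_phase D (k : nat) (alpha : R) : measurable D ->
  C D k alpha = cos (k%:R * (2 * pi) * alpha) * C D k 0 -
     sin (k%:R * (2 * pi) * alpha) * S D k.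
Proof.
move=> mD.
have iC : P.-integrable D (EFin \o (fun t => cos (k%:R * (2 * pi) * (U t + 0)))).
  apply: (@bounded_int (fun x => cos (k%:R * (2 * pi) * (x + 0)))) => //.
  by move=> x; rewrite ler_norml cos_geN1 cos_le1.
have iS : P.-integrable D (EFin \o (fun t => sin (k%:R * (2 * pi) * U t))).
  apply: (@bounded_int (fun x => sin (k%:R * (2 * pi) * x))) => //.
  by move=> x; rewrite ler_norml sin_geN1 sin_le1.
rewrite -!RintegralZl// -RintegralB//; last 2 first.
- exact: (@integrableZl _ _ _ _ _ mD _ _ iC).
- exact: (@integrableZl _ _ _ _ _ mD _ _ iS).
apply: eq_Rintegral => t _; rewrite mulrDr cosD addr0.
by rewrite [cos _ * cos _]mulrC [sin _ * sin _]mulrC.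
Qed.

Lemma integral_phase_kernel D k alpha : measurable D ->
  fine (\int[P]_(t in D) (phase_kernel k alpha (F1 (X1 t)))%:E)%E =
  fine (P D) - C D k alpha.
Proof.
move=> mD; rewrite -[LHS]/(\int[P]_(t in D) phase_kernel k alpha (U t)).
under eq_Rintegral do rewrite phase_kernelE.
have i1 : P.-integrable D (EFin \o (cst (1 : R))).
  by apply: finite_measure_integrable_cst.
rewrite (RintegralB mD i1); last first.
  apply: (@bounded_int (fun x => cos (k%:R * (2 * pi) * (x + alpha)))) => //.
  by move=> x; rewrite ler_norml cos_geN1 cos_le1.
by rewrite Rintegral_cst// mul1r.
Qed.

Lemma total_phase (k : nat) (alpha : R) : (0 < k)%N -> C setT k alpha = 0.
Proof.
move=> k0; have := integral_phase_kernel k alpha measurableT.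
rewrite (integral_kernel_rank FE FA (phase_kernel_is_kernel alpha k0)).
by rewrite probability_setT /=; move: (C _ _ _) => c; lra.
Qed.

Hypothesis bracket0 : forall (k : nat) (alpha : R), (1 <= k)%N -> 0 <= alpha < 1 ->
  let w := phase_kernel k alpha in
  forall x, lie_bracket (coord_field w fst) (coord_field w snd) f x = 0.

Section FixedLevel.
Variable s : R.
Hypothesis s01 : 0 < F2 s < 1.
Local Notation B := [set t | X2 t <= s].
Let mB : measurable B. Proof. exact: measurable_le_RV. Qed.

(** A point with first rank [1 / (2 * k) - alpha] is a zero of the derivative of
    the kernel in that coordinate, so the vanishing of the bracket there leaves a
    single product. *)
Lemma phase_product (k : nat) (alpha : R) : (0 < k)%N -> 0 <= alpha -> alpha < (2 * k%:R)^-1 ->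
  sin (k%:R * (2 * pi) * (F2 s + alpha)) * C B k alpha = 0.
Proof.
move=> k0 a0 ak.
have kR : 1 <= k%:R :> R by rewrite ler1n.
have k2 : (2 * k%:R)^-1 <= 1/2 :> R.
  by rewrite mul1r lef_pV2 ?posrE; lra.
have wK := phase_kernel_is_kernel alpha k0.
have dw z : 0 < z < 1 -> derivable (phase_kernel k alpha) z 1.
  by move=> _; case: (is_derive_phase_kernel k alpha z).
have [x1 x1E] := cdf_surj FE FA (u := (2 * k%:R)^-1 - alpha) ltac:(lra).
have fx : 0 < f (x1, s) by apply: Dplus_gt0_of_ranks => //; rewrite [F1 _]x1E; lra.
have := lie_bracket_multiplier fD Pf wK dw (x1, s).
rewrite bracket0//; last by rewrite a0 /=; lra.
move=> /esym/eqP; rewrite mulf_eq0 (gt_eqF fx) orbF /multiplier /=.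
rewrite !derive1E !(@derive_val _ _ _ _ _ _ _ (is_derive_phase_kernel k alpha _)).
rewrite x1E (_ : k%:R * (2 * pi) * ((2 * k%:R)^-1 - alpha + alpha) = pi); last first.
  by field; rewrite gt_eqF//; lra.
rewrite sinpi mulr0 mul0r subr0 (gamma_covE FE FA wK).
rewrite integral_phase_kernel// addrAC subrr add0r.
rewrite mulrN oppr_eq0 -[_ * sin _ * _]mulrA mulf_eq0 => /orP[|/eqP//].
  by rewrite gt_eqF// !mulr_gt0 ?pi_gt0 ?ltr0n.
Qed.

Lemma fourier_coef0 (k : nat) : (0 < k)%N -> C B k 0 = 0 /\ S B k = 0.
Proof.
move=> k0.
have kR : 1 <= k%:R :> R by rewrite ler1n.
have kn0 : k%:R != 0 :> R by rewrite gt_eqF//; lra.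
have lt c : 1 < c -> (2 * k%:R * c)^-1 < (2 * k%:R)^-1 :> R.
  move=> c1; rewrite ltf_pV2 ?posrE ?mulr_gt0//; try lra.
  by rewrite ltr_pMr//; lra.
have ge0 c : 1 < c -> 0 <= (2 * k%:R * c)^-1 :> R.
  by move=> c1; rewrite invr_ge0 !mulr_ge0//; lra.
have p0 := @phase_product k 0 k0 (lexx _) ltac:(by rewrite invr_gt0; lra).
have p2 := @phase_product k _ k0 (ge0 2 ltac:(lra)) (lt 2 ltac:(lra)).
have p4 := @phase_product k _ k0 (ge0 4 ltac:(lra)) (lt 4 ltac:(lra)).
have e2 : k%:R * (2 * pi) * (2 * k%:R * 2)^-1 = pi / 2 :> R by field.
have e4 : k%:R * (2 * pi) * (2 * k%:R * 4)^-1 = pi / 4 :> R by field.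
have psiE a : k%:R * (2 * pi) * (F2 s + a) =
    k%:R * (2 * pi) * F2 s + k%:R * (2 * pi) * a by rewrite mulrDr.
move: p0 p2 p4; rewrite addr0 !psiE e2 e4.
rewrite [C B k (2 * k%:R * 2)^-1]cos_phase// [C B k (2 * k%:R * 4)^-1]cos_phase//.
rewrite e2 e4 cos_pihalf sin_pihalf mul0r sub0r mul1r mulrN.
move=> p0 /eqP; rewrite oppr_eq0 => /eqP p2 p4.
exact: trig_factor_vanish p0 p2 p4.
Qed.

(** The rank of [X1] has vanishing trigonometric moments on [B], and also on the
    whole space because it is uniform; so it is decorrelated from [B].  The events
    on the rank are then traded for rays of [X1] up to null events. *)
Lemma rays_indep_interior r :
  P ([set t | X1 t <= r] `&` B) = (P [set t | (X1 t <= r)%R] * P B)%E.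
Proof.
have S0 k : (0 < k)%N -> S setT k = 0.
  move=> k0; have := @cos_phase setT k ((2 * k%:R * 2)^-1) measurableT.
  rewrite !total_phase// (_ : k%:R * (2 * pi) * _ = pi / 2); last first.
    by field; rewrite pnatr_eq0 -lt0n.
  by rewrite sin_pihalf mulr0 mul1r sub0r => /eqP; rewrite eq_sym oppr_eq0 => /eqP.
have C0E D k : \int[P]_(t in D) cos (k%:R * (2 * pi) * U t) = C D k 0.
  by apply: eq_Rintegral => t _; rewrite addr0.
have hc k : (0 < k)%N -> \int[P]_(t in B) cos (k%:R * (2 * pi) * U t) =
    fine (P B) * \int[P]_t cos (k%:R * (2 * pi) * U t).
  by move=> k0; rewrite !C0E total_phase// mulr0; have [] := fourier_coef0 k0.
have hs k : (0 < k)%N -> \int[P]_(t in B) sin (k%:R * (2 * pi) * U t) =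
    fine (P B) * \int[P]_t sin (k%:R * (2 * pi) * U t).
  move=> k0; rewrite -[LHS]/(S B k) -[\int[P]_t _]/(S setT k) S0// mulr0.
  by have [] := fourier_coef0 k0.
have U0 u := prob_rank_eq FE FA u.
have key := trig_decorrelation_indep mU mB hc hs (fun t => cdf01 FE (X1 t))
  (cdf01 FE r) (U0 0) (U0 1) (U0 (F1 r)).
have mX := measurable_le_RV X1 r.
have mlt : measurable [set t | U t < F1 r].
  rewrite (_ : [set t | _] = setT `&` U @^-1` `]-oo, F1 r[).
    by apply: mU => //; exact: measurable_itv.
  by rewrite setTI; apply/seteqP; split => t /=; rewrite in_itv.
have meq : measurable [set t | U t = F1 r].
  rewrite (_ : [set t | _] = setT `&` U @^-1` [set F1 r]); last by rewrite setTI.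
  by apply: mU => //; exact: measurable_set1.
have sub1 : [set t | U t < F1 r] `<=` [set t | X1 t <= r].
  move=> t /= Ut; rewrite leNgt; apply/negP => /ltW /(cdf_nd FE).
  by rewrite leNgt Ut.
have sub2 : [set t | X1 t <= r] `<=` [set t | U t < F1 r] `|` [set t | U t = F1 r].
  move=> t /= /(cdf_nd FE); rewrite le_eqVlt => /orP[/eqP|]; [by right|by left].
rewrite (prob_eq_mod_null _ _ meq _ _ (U0 (F1 r)) (C := [set t | U t < F1 r] `&` B)).
- rewrite key; congr (_ * _)%E.
  by apply/esym; apply: (prob_eq_mod_null _ _ meq _ _ (U0 (F1 r))).
- exact: measurableI.
- exact: measurableI.
- exact: setSI.
- by move=> t [/sub2 [?|?] ?]; [left|right].
Qed.

End FixedLevel.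

Lemma independent_of_bracket0 : independent_RV P X1 X2.
Proof.
apply: indep_of_rays => r s.
have mX := measurable_le_RV X1 r; have mY := measurable_le_RV X2 s.
have /andP[] := cdf01 GE s; rewrite le_eqVlt => /orP[/eqP s0 _|s0].
  rewrite [X in (_ = _ * X)%E]GE -s0 mule0.
  apply/eqP; rewrite -measure_le0 (_ : 0%E = P [set t | X2 t <= s]); last first.
    by rewrite GE -s0.
  by apply: le_measure; rewrite ?inE//; exact: measurableI.
rewrite le_eqVlt => /orP[/eqP s1|s1]; last by apply: rays_indep_interior; apply/andP.
have PY : P [set t | X2 t <= s] = 1%E by rewrite GE s1.
rewrite PY mule1; apply/esym.
apply: (@prob_eq_mod_null _ _ _ P _ _ (~` [set t | X2 t <= s])).
- exact: measurableI.
- exact: mX.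
- exact: measurableC.
- by move=> t [].
- by move=> t Xt; have [|] := pselect (X2 t <= s); [left|right].
- by rewrite probability_setC// PY subee.
Qed.

End Converse.

Unset Implicit Arguments.

Theorem theorem50 (R : realType) :
  (forall w : R -> R, is_kernel w ->
     (forall z : R, 0 < z < 1 -> derivable w z 1) ->
     (forall (d : measure_display) (T : measurableType d)
        (P : probability T R) (X1 X2 : {RV P >-> R}) (f : R * R -> R),
        Dplus f -> has_joint_density P X1 X2 f ->
        let L1 := coord_field w fst in
        let L2 := coord_field w snd in
        [/\ dir_derivable L2 f (L1 f),
            dir_derivable L1 f (L2 f),
            (forall x, lie_bracket L1 L2 f x = multiplier P X1 X2 w f x * f x) &
            (independent_RV P X1 X2 -> forall x, lie_bracket L1 L2 f x = 0)])
     /\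
     (forall (d d' : measure_display) (T : measurableType d)
        (T' : measurableType d') (P : probability T R) (P' : probability T' R)
        (X1 X2 : {RV P >-> R}) (Y1 Y2 : {RV P' >-> R}) (f g : R * R -> R),
        Dplus f -> has_joint_density P X1 X2 f ->
        Dplus g -> has_joint_density P' Y1 Y2 g ->
        (forall A : set (measurableTypeR R * measurableTypeR R), measurable A ->
           copula P X1 X2 f A = copula P' Y1 Y2 g A) ->
        forall x y : R * R,
          marginal_cdf fst f x.1 = marginal_cdf fst g y.1 ->
          marginal_cdf snd f x.2 = marginal_cdf snd g y.2 ->
          multiplier P X1 X2 w f x = multiplier P' Y1 Y2 w g y))
  /\
  (forall (d : measure_display) (T : measurableType d)
     (P : probability T R) (X1 X2 : {RV P >-> R}) (f : R * R -> R),
     Dplus f -> has_joint_density P X1 X2 f ->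
     (forall (k : nat) (alpha : R), (1 <= k)%N -> 0 <= alpha < 1 ->
        let w := phase_kernel k alpha in
        forall x, lie_bracket (coord_field w fst) (coord_field w snd) f x = 0) ->
     independent_RV P X1 X2).
Proof.
split.
  move=> w wK dw; split.
    move=> d T P X1 X2 f fD Pf L1 L2; split.
    - exact: dir_derivable_snd fD Pf wK dw.
    - exact: dir_derivable_fst fD Pf wK dw.
    - exact: lie_bracket_multiplier fD Pf wK dw.
    - move=> ind x; rewrite (lie_bracket_multiplier fD Pf wK dw).
      by rewrite (multiplier_indep fD Pf wK)// mul0r.
  move=> d d' T T' P P' X1 X2 Y1 Y2 f g fD Pf gD Pg.
  exact: multiplier_copula wK fD Pf gD Pg.
by move=> d T P X1 X2 f fD Pf; exact: independent_of_bracket0 fD Pf.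
Qed.
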